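(* Let $M$ be a complete separable (pointed) metric space. Then the following are equivalent: (i) for every $\varepsilon>0$, the Lipschitz-free space $\mathcal{F}(M)$ is $(1+\varepsilon)$-isomorphic to a subspace of $\ell_1$; (ii) $M$ is (isometric to) a subset of an $\mathbb{R}$-tree such that $\lambda(M)=0$.
   Context: All Banach spaces are real. For a metric space $(M,d)$ with a base point $0\in M$, $\mathrm{Lip}_0(M)$ is the Banach space of all Lipschitz functions $f\colon M\to\mathbb{R}$ with $f(0)=0$, normed by the Lipschitz constant $\|f\|_L$. Let $\delta\colon M\to \mathrm{Lip}_0(M)^*$, $\langle f,\delta(x)\rangle=f(x)$. The Lipschitz-free space is $\mathcal{F}(M)=\overline{\mathrm{span}}\,\delta(M)\subset \mathrm{Lip}_0(M)^*$. A Banach space $X$ is $(1+\varepsilon)$-isomorphic to a subspace of a Banach space $Y$ if there is a linear operator $S\colon X\to Y$ with $\|u\|\le\|S(u)\|\le(1+\varepsilon)\|u\|$ for all $u\in X$. An $\mathbb{R}$-tree is an arc-connected metric space $(T,d)$ such that any two points $x\neq y$ are joined by a unique arc, and this arc is isometric to the real segment $[0,d(x,y)]$. The arc is denoted $[x,y]$ and called a segment; $\phi_{xy}\colon[x,y]\to[0,d(x,y)]$ denotes the isometry. Length measure $\lambda$ on $T$: a set $E\subset[x,y]$ is measurable if $\phi_{xy}(E)$ is Lebesgue measurable, and then $\lambda(E)$ is the Lebesgue measure of $\phi_{xy}(E)$. An arbitrary $E\subset T$ is measurable if $E\cap I$ is measurable for every segment $I$ of $T$, and then $\lambda(E)=\sup\{\sum_{k=1}^n\lambda(E\cap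 I_k): I_1,\dots,I_n \text{ disjoint segments in } T\}$. If a metric space $M$ is a subset of an $\mathbb{R}$-tree, there is, up to isometry, a unique minimal $\mathbb{R}$-tree containing $M$, denoted $\mathrm{conv}(M)$; the length measure on $M$ is the restriction of that of $\mathrm{conv}(M)$. *)

(* Defs.v *)
From HB Require Import structures.
From mathcomp Require Import all_boot all_order all_algebra.
From mathcomp Require Import all_classical all_reals all_analysis.

Set Implicit Arguments.
Unset Strict Implicit.
Unset Printing Implicit Defensive.

Import Order.TTheory GRing.Theory Num.Theory.
Import numFieldNormedType.Exports.

Local Open Scope classical_set_scope.
Local Open Scope ring_scope.

#[short(type="completeMetricType")]
HB.structure Definition CompleteMetric (K : numFieldType) :=
  {M of Metric K M & Complete M}.

Definition separable (T : topologicalType) : Prop :=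
  exists2 D : set T, countable D & dense D.

Definition isometry_on (R : realType) (S T : metricType R) (A : set S)
    (f : S -> T) : Prop :=
  forall p q, A p -> A q -> mdist (f p) (f q) = mdist p q.

Section sup_norm.
Context {R : realType}.

Lemma sup_ubP (A : set R) r : has_ubound A -> A r -> r <= sup A.
Proof. by move=> uA Ar; apply: sup_upper_bound => //; split => //; exists r. Qed.

Lemma sup_le_ub0 (A : set R) c : 0 <= c -> ubound A c -> sup A <= c.
Proof.
move=> c0 Ac; have [->|/set0P A0] := eqVneq A set0; first by rewrite sup0.
exact: ge_sup.
Qed.

Lemma sup_nneg (A : set R) :
  (forall r, A r -> 0 <= r) -> has_ubound A -> 0 <= sup A.
Proof.
move=> A0 uA; have [->|/set0P[r Ar]] := eqVneq A set0; first by rewrite sup0.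
exact: le_trans (A0 _ Ar) (sup_ubP uA Ar).
Qed.

End sup_norm.

Section Lip0.
Context {R : realType} {M : metricType R} (x0 : M).
Implicit Types f g : M -> R.

Definition lipschitz_with (L : R) f : Prop :=
  forall x y, `|f x - f y| <= L * mdist x y.

Definition lip0 : {pred M -> R} :=
  [pred f | `[< f x0 = 0 /\ exists L, lipschitz_with L f >]].

Lemma lip0_submod_closed : submod_closed lip0.
Proof.
split; first by apply/asboolP; split=> //; exists 0 => x y;
  rewrite subrr normr0 mul0r.
move=> a f g /asboolP[f0 [L fL]] /asboolP[g0 [K gK]]; apply/asboolP; split.
  by rewrite /= !fctE f0 g0 scaler0 addr0.
exists (`|a| * L + K) => x y; rewrite !fctE opprD addrACA -scalerBr.
rewrite (le_trans (ler_normD _ _))// mulrDl lerD// normrM -mulrA.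
by rewrite ler_wpM2l.
Qed.

HB.instance Definition _ := GRing.isSubmodClosed.Build _ _ lip0
  lip0_submod_closed.

Record Lip0 := MkLip0 { lip0_fun :> M -> R ; _ : lip0_fun \in lip0 }.

HB.instance Definition _ := [isSub for lip0_fun].
HB.instance Definition _ := [Choice of Lip0 by <:].
HB.instance Definition _ := [SubChoice_isSubLmodule of Lip0 by <:].

Definition slopes f : set R :=
  [set r | exists x y, x <> y /\ r = `|f x - f y| / mdist x y].

Definition lipnorm (f : Lip0) : R := sup (slopes f).

Lemma slopes_ubP L f : 0 <= L -> ubound (slopes f) L <-> lipschitz_with L f.
Proof.
move=> L0; split=> [fL x y|fL _ [x [y [xy ->]]]].
  have [->|/eqP xy] := eqVneq x y; first by rewrite subrr normr0 mulr_ge0// mdist_ge0.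
  rewrite -ler_pdivrMr; last by rewrite mdist_gt0; exact/eqP.
  by apply: fL; exists x, y.
by rewrite ler_pdivrMr ?mdist_gt0//; exact/eqP.
Qed.

Lemma Lip0P (f : Lip0) : f x0 = 0 /\ exists2 L, 0 <= L & lipschitz_with L f.
Proof.
case: f => f /= /asboolP[f0 [L fL]]; split=> //.
exists `|L| => // x y; apply: le_trans (fL x y) _.
by rewrite ler_wpM2r ?mdist_ge0// ler_norm.
Qed.

Lemma lipnorm_ge0 (f : Lip0) : 0 <= lipnorm f.
Proof.
have [_ [L L0 /(slopes_ubP _ L0) fL]] := Lip0P f.
apply: sup_nneg; last by exists L.
by move=> _ [x [y [_ ->]]]; rewrite divr_ge0 ?mdist_ge0.
Qed.

Lemma lipnormP (f : Lip0) : lipschitz_with (lipnorm f) f.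
Proof.
apply/slopes_ubP; first exact: lipnorm_ge0.
have [_ [L L0 /(slopes_ubP _ L0) fL]] := Lip0P f.
by move=> r; apply: sup_ubP; exists L.
Qed.

Lemma lipnorm_le (f : Lip0) L : 0 <= L -> lipschitz_with L f -> lipnorm f <= L.
Proof. by move=> L0 /slopes_ubP fL; apply: sup_le_ub0 => //; exact: fL. Qed.

Lemma lipnormD (f g : Lip0) : lipnorm (f + g) <= lipnorm f + lipnorm g.
Proof.
apply: lipnorm_le => [|x y]; first by rewrite addr_ge0 ?lipnorm_ge0.
rewrite [X in `|X|](_ : _ = (f x - f y) + (g x - g y)); last first.
  by rewrite addrACA -opprD.
by rewrite mulrDl (le_trans (ler_normD _ _))// lerD//; exact: lipnormP.
Qed.

Lemma lipnormZ_le a (f : Lip0) : lipnorm (a *: f) <= `|a| * lipnorm f.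
Proof.
apply: lipnorm_le => [|x y]; first by rewrite mulr_ge0 ?lipnorm_ge0.
rewrite [X in `|X|](_ : _ = a * (f x - f y)); last by rewrite mulrBr.
by rewrite normrM -mulrA ler_wpM2l//; exact: lipnormP.
Qed.

Lemma lipnormZ a (f : Lip0) : lipnorm (a *: f) = `|a| * lipnorm f.
Proof.
apply/eqP; rewrite eq_le lipnormZ_le/=; have [->|a0] := eqVneq a 0.
  by rewrite normr0 mul0r lipnorm_ge0.
rewrite -ler_pdivlMl ?normr_gt0// -normfV.
by rewrite -[in leLHS](scalerK a0 f) lipnormZ_le.
Qed.

Lemma lipnorm0_eq0 (f : Lip0) : lipnorm f = 0 -> f = 0.
Proof.
move=> f0; apply/val_inj/funext => x /=.
have := lipnormP f x x0; rewrite f0 mul0r normr_le0 subr_eq0 => /eqP ->.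
by have [-> _] := Lip0P f.
Qed.

HB.instance Definition _ :=
  Lmodule_isNormed.Build R Lip0 lipnormD lipnormZ lipnorm0_eq0.

End Lip0.

Section dual.
Context {R : realType} (V : normedModType R).
Implicit Types f g : V -> R.

Definition bounded_functional : {pred V -> R} :=
  [pred f | `[< (forall a u v, f (a *: u + v) = a * f u + f v) /\
                exists C, forall v, `|f v| <= C * `|v| >]].

Lemma bounded_functional_submod_closed : submod_closed bounded_functional.
Proof.
split.
  apply/asboolP; split=> [a u v|]; first by rewrite mulr0 addr0.
  by exists 0 => v; rewrite normr0 mul0r.
move=> a f g /asboolP[fl [C fC]] /asboolP[gl [D gD]]; apply/asboolP; split.
  move=> b u v; rewrite /= !fctE fl gl /GRing.scale/=.
  by rewrite !mulrDr addrACA !mulrA (mulrC a b).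
exists (`|a| * C + D) => v; rewrite !fctE (le_trans (ler_normD _ _))//.
by rewrite mulrDl lerD// normrM -mulrA ler_wpM2l.
Qed.

HB.instance Definition _ := GRing.isSubmodClosed.Build _ _ bounded_functional
  bounded_functional_submod_closed.

Record dual :=
  MkDual { dual_fun :> V -> R ; _ : dual_fun \in bounded_functional }.

HB.instance Definition _ := [isSub for dual_fun].
HB.instance Definition _ := [Choice of dual by <:].
HB.instance Definition _ := [SubChoice_isSubLmodule of dual by <:].

Definition dualnorm (f : dual) : R := sup [set `|f v| | v in [set v | `|v| <= 1]].

Lemma dualP (f : dual) : (forall a u v, f (a *: u + v) = a * f u + f v) /\
  exists2 C, 0 <= C & forall v, `|f v| <= C * `|v|.
Proof.
case: f => f /= /asboolP[fl [C fC]]; split=> //.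
exists `|C| => // v; apply: le_trans (fC v) _.
by rewrite ler_wpM2r// ler_norm.
Qed.

Lemma dual0 (f : dual) : f 0 = 0.
Proof.
have [fl _] := dualP f; have := fl 1 0 0.
by rewrite scaler0 addr0 mul1r => /eqP; rewrite -subr_eq subrr => /eqP.
Qed.

Lemma dualZ (f : dual) a v : f (a *: v) = a * f v.
Proof. by have [fl _] := dualP f; have := fl a v 0; rewrite !addr0 dual0 addr0. Qed.

Lemma dual_has_ub (f : dual) :
  has_ubound [set `|f v| | v in [set v | `|v| <= 1]].
Proof.
have [_ [C C0 fC]] := dualP f; exists C => _ [v /= v1 <-].
by rewrite (le_trans (fC v))// ler_piMr.
Qed.

Lemma dualnorm_ge0 (f : dual) : 0 <= dualnorm f.
Proof. by apply: sup_nneg; [move=> _ [v _ <-]|exact: dual_has_ub]. Qed.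

Lemma dualnormP (f : dual) v : `|f v| <= dualnorm f * `|v|.
Proof.
have [->|v0] := eqVneq v 0; first by rewrite dual0 !normr0 mulr0.
rewrite -ler_pdivrMr ?normr_gt0//.
have -> : `|f v| / `|v| = `|f (`|v|^-1 *: v)|.
  by rewrite dualZ normrM normfV normr_id mulrC.
apply: sup_ubP; first exact: dual_has_ub.
by exists (`|v|^-1 *: v) => //=; rewrite normrZ normfV normr_id mulVf ?normr_eq0.
Qed.

Lemma dualnorm_le (f : dual) C :
  0 <= C -> (forall v, `|f v| <= C * `|v|) -> dualnorm f <= C.
Proof.
move=> C0 fC; apply: sup_le_ub0 => // _ [v /= v1 <-].
by rewrite (le_trans (fC v))// ler_piMr.
Qed.

Lemma dualnormD (f g : dual) : dualnorm (f + g) <= dualnorm f + dualnorm g.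
Proof.
apply: dualnorm_le => [|v]; first by rewrite addr_ge0 ?dualnorm_ge0.
by rewrite (le_trans (ler_normD _ _))// mulrDl lerD//; exact: dualnormP.
Qed.

Lemma dualnormZ_le a (f : dual) : dualnorm (a *: f) <= `|a| * dualnorm f.
Proof.
apply: dualnorm_le => [|v]; first by rewrite mulr_ge0 ?dualnorm_ge0.
by rewrite [leLHS]normrM -mulrA ler_wpM2l//; exact: dualnormP.
Qed.

Lemma dualnormZ a (f : dual) : dualnorm (a *: f) = `|a| * dualnorm f.
Proof.
apply/eqP; rewrite eq_le dualnormZ_le/=; have [->|a0] := eqVneq a 0.
  by rewrite normr0 mul0r dualnorm_ge0.
rewrite -ler_pdivlMl ?normr_gt0// -normfV.
by rewrite -[in leLHS](scalerK a0 f) dualnormZ_le.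
Qed.

Lemma dualnorm0_eq0 (f : dual) : dualnorm f = 0 -> f = 0.
Proof.
move=> f0; apply/val_inj/funext => v /=.
by have := dualnormP f v; rewrite f0 mul0r normr_le0 => /eqP.
Qed.

HB.instance Definition _ :=
  Lmodule_isNormed.Build R dual dualnormD dualnormZ dualnorm0_eq0.

End dual.

Section closed_span.
Context {R : realType} {V : normedModType R}.

Definition linear_span (A : set V) : set V :=
  [set v | exists n (a : 'I_n -> R) (w : 'I_n -> V),
    (forall k, A (w k)) /\ v = \sum_(k < n) a k *: w k].

Definition closed_span (A : set V) : {pred V} :=
  [pred v | `[< closure (linear_span A) v >]].

Lemma linear_span0 (A : set V) : linear_span A 0.
Proof.
exists 0%N, (fun=> 0), (fun=> 0); split; first by case.
by rewrite big_ord0.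
Qed.

Lemma linear_spanD (A : set V) b u v :
  linear_span A u -> linear_span A v -> linear_span A (b *: u + v).
Proof.
move=> [n [a [w [Aw ->]]]] [m [c [z [Az ->]]]].
exists (n + m)%N,
  (fun k => match fintype.split k with inl i => b * a i | inr j => c j end),
  (fun k => match fintype.split k with inl i => w i | inr j => z j end); split.
  by move=> k; case: fintype.split.
rewrite big_split_ord/= scaler_sumr; congr (_ + _); apply: eq_bigr => k _.
  by case: split_ordP => j /eqP; rewrite eq_shift// => /eqP ->; rewrite scalerA.
by case: split_ordP => j /eqP; rewrite eq_shift// => /eqP ->.
Qed.

Lemma closed_span_submod_closed (A : set V) : submod_closed (closed_span A).
Proof.
split; first by apply/asboolP/subset_closure; exact: linear_span0.
move=> a u v /asboolP Au /asboolP Av; apply/asboolP => B Bauv.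
have cf : continuous (fun p : V * V => a *: p.1 + p.2).
  move=> p; apply: cvgD; last exact: cvg_snd.
  by apply: cvgZr; exact: cvg_fst.
have [[B1 B2]/= [uB1 vB2] B12] := cf (u, v) _ Bauv.
have [u' [Au' B1u']] := Au _ uB1; have [v' [Av' B2v']] := Av _ vB2.
exists (a *: u' + v'); split; first exact: linear_spanD.
exact: (B12 (u', v')).
Qed.

HB.instance Definition _ (A : set V) := GRing.isSubmodClosed.Build _ _
  (closed_span A) (closed_span_submod_closed A).

End closed_span.

Section free_space.
Context {R : realType} {M : metricType R} (x0 : M).

Lemma delta_subproof (x : M) :
  (fun f : Lip0 x0 => f x) \in @bounded_functional R (Lip0 x0).
Proof.
apply/asboolP; split=> // ; exists (mdist x x0) => f.
have [f0 _] := Lip0P f; have := lipnormP f x x0.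
by rewrite f0 subr0 mulrC.
Qed.

Definition delta (x : M) : dual (Lip0 x0) := MkDual (delta_subproof x).

Record free_space := MkFree {
  free_val :> dual (Lip0 x0) ;
  _ : free_val \in closed_span (range delta) }.

HB.instance Definition _ := [isSub for free_val].
HB.instance Definition _ := [Choice of free_space by <:].
HB.instance Definition _ := [SubChoice_isSubLmodule of free_space by <:].

Definition freenorm (u : free_space) : R := `|free_val u|.

Lemma freenormD u v : freenorm (u + v) <= freenorm u + freenorm v.
Proof. exact: ler_normD. Qed.

Lemma freenormZ a u : freenorm (a *: u) = `|a| * freenorm u.
Proof. exact: normrZ. Qed.

Lemma freenorm0_eq0 u : freenorm u = 0 -> u = 0.
Proof. by move/normr0_eq0 => u0; apply/val_inj. Qed.

HB.instance Definition _ :=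
  Lmodule_isNormed.Build R free_space freenormD freenormZ freenorm0_eq0.

End free_space.

Section ell1.
Context (R : realType).
Implicit Types u v : nat -> R.

Definition abs_series u : R^nat := series (fun k => `|u k|).

Definition summable_seq : {pred nat -> R} :=
  [pred u | `[< cvgn (abs_series u) >]].

Lemma abs_series_nd u : nondecreasing_seq (abs_series u).
Proof. by apply: nondecreasing_series => n _ _; exact: normr_ge0. Qed.

Lemma abs_series_le u C : (forall n, abs_series u n <= C) ->
  cvgn (abs_series u) /\ limn (abs_series u) <= C.
Proof.
move=> uC; have cu : cvgn (abs_series u).
  apply: nondecreasing_is_cvgn; first exact: abs_series_nd.
  by exists C => _ [n _ <-].
by split=> //; apply: limr_le => //; exact: nearW.
Qed.

Lemma abs_series_lim u n : cvgn (abs_series u) ->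
  abs_series u n <= limn (abs_series u).
Proof. by move=> cu; apply: nondecreasing_cvgn_le => //; exact: abs_series_nd. Qed.

Lemma abs_seriesD_le u v n : cvgn (abs_series u) ->
  cvgn (abs_series v) -> abs_series (u \+ v) n <=
  limn (abs_series u) + limn (abs_series v).
Proof.
move=> cu cv.
rewrite (le_trans _ (lerD (abs_series_lim n cu) (abs_series_lim n cv)))//.
by rewrite /= /abs_series/series/= -big_split/=; apply: ler_sum => k _; exact: ler_normD.
Qed.

Lemma abs_seriesZ_le a u n : cvgn (abs_series u) ->
  abs_series (fun k => a * u k) n <= `|a| * limn (abs_series u).
Proof.
move=> cu; rewrite (le_trans _ (ler_wpM2l _ (abs_series_lim n cu)))//.
by rewrite /= /abs_series/series/= mulr_sumr; apply: ler_sum => k _; rewrite normrM.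
Qed.

Lemma summable_seq_submod_closed : submod_closed summable_seq.
Proof.
split.
  apply/asboolP; apply: (abs_series_le (C := 0) _).1 => n /=.
  by rewrite /abs_series/series/= big1// => k _; rewrite normr0.
move=> a u v /asboolP cu /asboolP cv; apply/asboolP.
have cau : cvgn (abs_series (fun k => a * u k)).
  by apply: (abs_series_le _).1 => n; exact: abs_seriesZ_le.
by apply: (abs_series_le _).1 => n; exact: abs_seriesD_le.
Qed.

HB.instance Definition _ := GRing.isSubmodClosed.Build _ _ summable_seq
  summable_seq_submod_closed.

Record ell1 := MkEll1 { ell1_fun :> nat -> R ; _ : ell1_fun \in summable_seq }.

HB.instance Definition _ := [isSub for ell1_fun].
HB.instance Definition _ := [Choice of ell1 by <:].
HB.instance Definition _ := [SubChoice_isSubLmodule of ell1 by <:].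

Definition ell1norm (u : ell1) : R := limn (abs_series u).

Lemma ell1P (u : ell1) : cvgn (abs_series u).
Proof. by case: u => u /= /asboolP. Qed.

Arguments ell1P : clear implicits.

Lemma ell1norm_ge0 (u : ell1) : 0 <= ell1norm u.
Proof.
have := abs_series_lim 0%N (ell1P u).
by rewrite {1}/abs_series/series/= big_geq.
Qed.

Lemma ell1normD (u v : ell1) : ell1norm (u + v) <= ell1norm u + ell1norm v.
Proof.
by apply: (abs_series_le _).2 => n; apply: abs_seriesD_le; exact: ell1P.
Qed.

Lemma ell1normZ_le a (u : ell1) : ell1norm (a *: u) <= `|a| * ell1norm u.
Proof.
by apply: (abs_series_le _).2 => n; apply: abs_seriesZ_le; exact: ell1P.
Qed.

Lemma ell1normZ a (u : ell1) : ell1norm (a *: u) = `|a| * ell1norm u.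
Proof.
apply/eqP; rewrite eq_le ell1normZ_le/=; have [->|a0] := eqVneq a 0.
  by rewrite normr0 mul0r ell1norm_ge0.
rewrite -ler_pdivlMl ?normr_gt0// -normfV.
by rewrite -[in leLHS](scalerK a0 u) ell1normZ_le.
Qed.

Lemma ell1norm0_eq0 (u : ell1) : ell1norm u = 0 -> u = 0.
Proof.
move=> u0; apply/val_inj/funext => n /=; apply/eqP; rewrite -normr_le0.
have := abs_series_lim n.+1 (ell1P u); rewrite -/(ell1norm u) u0.
rewrite /abs_series/series/= big_nat_recr//=; apply: le_trans.
by rewrite lerDr sumr_ge0.
Qed.

HB.instance Definition _ :=
  Lmodule_isNormed.Build R ell1 ell1normD ell1normZ ell1norm0_eq0.

End ell1.

Definition iso_to_subspace (R : realType) (e : R) (X Y : normedModType R) : Prop :=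
  exists S : {linear X -> Y}, forall u, `|u| <= `|S u| <= (1 + e) * `|u|.

Section rtree.
Context {R : realType} {T : metricType R}.
Implicit Types (x y p : T) (C E I J : set T).

Definition is_arc x y I : Prop := exists g : R -> T,
  [/\ {within `[0, 1], continuous g}, set_inj `[0, 1] g,
      g 0 = x, g 1 = y & g @` `[0, 1] = I].

(* The subset C, with the induced metric, is an R-tree. *)
Definition rtree C : Prop := forall x y, C x -> C y -> x <> y ->
  exists I, [/\ I `<=` C, is_arc x y I,
    forall J, J `<=` C -> is_arc x y J -> J = I &
    exists phi : T -> R^o,
      isometry_on I phi /\ phi @` I = `[0, mdist x y]%classic].

(* The minimal R-tree containing A, for a subset A of an R-tree T: there an
   intersection of subtrees is a subtree (see rtree_rtree_conv). *)
Definition rtree_conv (A : set T) : set T := smallest rtree A.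

Lemma rtree_rtree_conv (A : set T) : rtree [set: T] -> rtree (rtree_conv A).
Proof.
move=> treeT x y Cx Cy xy.
have [I [_ arcI uniqI isoI]] := treeT x y Logic.I Logic.I xy.
exists I; split=> //; last by move=> J _; exact: uniqI.
move=> p Ip B [treeB AB].
have [J [JB arcJ _ _]] := treeB x y (Cx B (conj treeB AB)) (Cy B (conj treeB AB)) xy.
by apply: JB; rewrite (uniqI J).
Qed.

(* I is the segment [x, y] of the R-tree C. *)
Definition segment C x y I : Prop := [/\ x <> y, I `<=` C & is_arc x y I].

(* The isometry of [x, y] onto [0, mdist x y] that maps x to 0 is, on [x, y],
   the distance to x (see segment_chartP). *)
Definition segment_chart x : T -> R := mdist x.

Lemma segment_chartP x y I (phi : T -> R^o) : I x -> isometry_on I phi ->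
  phi @` I = `[0, mdist x y]%classic -> phi x = 0 ->
  forall p, I p -> phi p = segment_chart x p.
Proof.
move=> Ix phiI phiE phix p Ip; rewrite /segment_chart -(phiI _ _ Ix Ip).
have : `[0, mdist x y]%classic (phi p) by rewrite -phiE; exists p.
by rewrite /= in_itv/= phix => /andP[p0 _]; rewrite /mdist/= subr0 ger0_norm.
Qed.

(* The domain of completed_lebesgue_measure: the completed Borel sigma-algebra
   (completed_caratheodory_measurable in lebesgue_measure). *)
Definition lebesgue_measurable (B : set R) : Prop :=
  (wlength idfun)^*%mu.-cara.-measurable B.

Definition segment_measure x E : \bar R :=
  completed_lebesgue_measure (segment_chart x @` E).

Definition length_measurable C E : Prop := forall x y I, segment C x y I ->
  lebesgue_measurable (segment_chart x @` (E `&` I)).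

(* Each piece E `&` I k is measured through the chart of the segment I k.
   n = 0 is allowed, so that the measure is 0 in a tree without segments. *)
Definition length_measure C E : \bar R :=
  ereal_sup [set s | exists n (x y : 'I_n -> T) (I : 'I_n -> set T),
    [/\ forall k, segment C (x k) (y k) (I k), trivIset setT I &
        s = (\sum_(k < n) segment_measure (x k) (E `&` I k))%E]].

End rtree.

(* Main.v *)
Require Import Defs.
From HB Require Import structures.
From mathcomp Require Import all_boot all_order all_algebra.
From mathcomp Require Import all_classical all_reals all_analysis.
From mathcomp Require Import ring lra.

Set Implicit Arguments.
Unset Strict Implicit.
Unset Printing Implicit Defensive.

Import Order.TTheory GRing.Theory Num.Theory.
Import numFieldNormedType.Exports.

Local Open Scope classical_set_scope.
Local Open Scope ring_scope.

(** Both implications go through two conditions on the metric space [M] itself: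
    the four-point condition, which characterizes the subsets of R-trees, and
    the nullity of the set of heights that [M] occupies on each segment of the
    tree ([heights_on]).

    If the free space almost embeds into l1, then Hlawka's inequality, which
    holds in l1 coordinate by coordinate, passes to the free space.  For the
    three molecules along a path x, u, y, v it says that
    d(x,y) + d(u,v) + min(B,C) <= B + C, where B = d(x,u) + d(y,v) and
    C = d(x,v) + d(y,u), and this is the four-point condition
    ([ell1_embedding_four_point]).  The tree is then built from pairs (point,
    height) above a base point ([tree_hull]); its arcs are unique because, by
    the four-point condition, an interior point of a geodesic separates the
    endpoints ([geodesic_four_point_rtree]).  If [M] had positive measure on a
    segment, it would contain chains of arbitrarily short steps of a fixed total
    length.  Signs can be chosen greedily so that the signed sum of the steps is
    small on any given finite number of coordinates of l1; and the remaining
    coordinates carry little of the steps altogether, since the embedding is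
    almost isometric and finitely many coordinates carry almost all of the norm of
    the image of the molecule of the two ends of the chain.  But the signed sum has the norm of the total length
    ([ell1_embedding_null]).

    Conversely, let [M] be a null subset of a tree, with a dense sequence [x k].
    The hull of [M] is the union of countably many segments, the k-th one running
    from the hull of the preceding points to [x k].  Since [M] is complete, each
    segment minus [M] is cut into countably many pieces, each short compared with
    every branch of the hull that leaves it ([whitney_decomposition],
    [good_piece]), by a factor [eps k] on the k-th segment.  The cut functions,
    worth the length of a piece at the points beyond it and 0 elsewhere, define
    the map u |-> (u(f_N))_N to l1.  The distance of two points is the total
    length of the pieces between them up to the pieces that their branches leave
    in the middle.  At most one piece on each segment is lost in this way, and
    the [eps k] are summable: so the sum of the cuts is almost the distance
    ([cut_metric_le], [cut_metric_ge]).  The upper estimate bounds the map above.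
    The lower one bounds it below, because the cuts are laminar: a Lipschitz
    function on finitely many points is a combination of the cuts with
    coefficients bounded by the weights ([laminar_duality]). *)

(** * Outer length of subsets of the line *)

Section outer_length.
Context {R : realType}.
Implicit Types A B : set R.

(** As a function on all sets, the completed Lebesgue measure is the outer
    measure of the length of intervals: it is subadditive on arbitrary sets. *)
Definition outer_length A : \bar R := completed_lebesgue_measure A.

Lemma outer_length_ge0 A : (0 <= outer_length A)%E.
Proof. exact: (@outer_measure_ge0 _ _ ((wlength idfun)^*)%mu). Qed.

Lemma le_outer_length A B : A `<=` B -> (outer_length A <= outer_length B)%E.
Proof. exact: (@le_outer_measure _ _ ((wlength idfun)^*)%mu). Qed.

Lemma outer_length_bigcup (F : (set R)^nat) :
  (outer_length (\bigcup_n F n) <= \sum_(n <oo) outer_length (F n))%E.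
Proof. exact: (@outer_measure_sigma_subadditive _ _ ((wlength idfun)^*)%mu). Qed.

Lemma outer_lengthU A B :
  (outer_length (A `|` B) <= outer_length A + outer_length B)%E.
Proof. exact: (@outer_measureU2 _ _ ((wlength idfun)^*)%mu). Qed.

Lemma outer_length_itvoc (a b : R) : a <= b ->
  outer_length `]a, b] = (b - a)%:E.
Proof.
move=> ab.
have -> : outer_length `]a, b] = lebesgue_measure `]a, b]%classic by [].
rewrite lebesgue_measure_itv/= lte_fin.
by case: ltgtP ab => // -> _; rewrite subrr.
Qed.

Lemma outer_length0_measurable A : outer_length A = 0%E -> lebesgue_measurable A.
Proof.
move=> A0; apply: le_caratheodory_measurable => X /=.
have -> : ((wlength idfun)^*)%mu (X `&` A) = 0%E.
  apply/eqP; rewrite eq_le outer_measure_ge0 andbT -A0.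
  by apply: le_outer_measure; exact: subIsetr.
by rewrite add0e; apply: le_outer_measure; exact: subIsetl.
Qed.

Lemma outer_length_subset0 A B : A `<=` B -> outer_length B = 0%E ->
  outer_length A = 0%E.
Proof.
move=> AB B0; apply/eqP; rewrite eq_le outer_length_ge0 andbT -B0.
exact: le_outer_length.
Qed.

Lemma outer_length_set1 (a : R) : outer_length [set a] = 0%E.
Proof. exact: lebesgue_measure_set1. Qed.

(** Half-open intervals; an interval with [b i <= a i] is empty and meets no
    other one. *)
Definition disjoint_intervals (I : Type) (P : set I) (a b : I -> R) : Prop :=
  forall i j t, P i -> P j -> a i < t <= b i -> a j < t <= b j -> i = j.

Lemma disjoint_intervals_length n (P : pred 'I_n) (a b : 'I_n -> R) (c d : R) :
  c <= d -> (forall i, P i -> c <= a i /\ a i <= b i <= d) ->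
  disjoint_intervals P a b ->
  \sum_(i < n | P i) (b i - a i) <= d - c.
Proof.
move=> cd abP dis; rewrite -lee_fin.
have -> : (d - c)%:E = lebesgue_measure `]c, d]%classic.
  by rewrite -[LHS]outer_length_itvoc.
have -> : (\sum_(i < n | P i) (b i - a i))%:E =
    (\sum_(i < n | P i) lebesgue_measure `]a i, b i]%classic)%E.
  rewrite -sumEFin; apply: eq_bigr => i /abP[_ /andP[ab _]].
  by rewrite -[LHS]outer_length_itvoc.
rewrite -measure_bigsetU_ord_cond//; last first.
  move=> i j Pi Pj [t [/=]]; rewrite !in_itv/= => ti tj.
  exact: (dis i j t).
apply: le_measure; rewrite ?inE//.
  by apply: bigsetU_measurable => i _.
apply: (big_ind (fun A : set R => A `<=` `]c, d]%classic)) => // [A B Ac Bc|i].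
  by rewrite subUset.
move=> /abP[ca /andP[_ bd]] t/=; rewrite !in_itv/=.
by move=> /andP[lt1 t2]; rewrite (le_lt_trans ca)//= (le_trans t2).
Qed.

Lemma outer_length_bigcup0 (F : (set R)^nat) :
  (forall n, outer_length (F n) = 0%E) -> outer_length (\bigcup_n F n) = 0%E.
Proof.
move=> F0; apply/eqP; rewrite eq_le outer_length_ge0 andbT.
by apply: le_trans (outer_length_bigcup F) _; rewrite eseries0.
Qed.

Lemma outer_length_bigcup_itv (a b : nat -> R) (C : R) :
  (forall n, a n <= b n) -> (forall n, \sum_(i < n) (b i - a i) <= C) ->
  (outer_length (\bigcup_n `]a n, b n]%classic) <= C%:E)%E.
Proof.
move=> ab abC; apply: le_trans (outer_length_bigcup _) _.
apply: lime_le; first by apply: is_cvg_nneseries => n _ _; exact: outer_length_ge0.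
apply: nearW => n /=; rewrite big_mkord.
under eq_bigr do rewrite outer_length_itvoc//.
by rewrite sumEFin lee_fin.
Qed.

End outer_length.

(** * Dyadic Whitney decomposition *)

Section whitney.
Context {R : realType}.

Definition dyadic_rank (i : nat) (t : R) : int := Num.ceil (t * 2 ^+ i).
Definition dyadic_inf (i : nat) (j : int) : R := (j - 1)%:~R / 2 ^+ i.
Definition dyadic_sup (i : nat) (j : int) : R := j%:~R / 2 ^+ i.

Let pow2_gt0 i : 0 < 2 ^+ i :> R. Proof. exact: exprn_gt0. Qed.

Lemma dyadicP i j t :
  (dyadic_inf i j < t <= dyadic_sup i j) = (dyadic_rank i t == j).
Proof. by rewrite /dyadic_rank ceil_eq ltr_pdivrMr// ler_pdivlMr. Qed.

(** Multiplying by a power of 2 maps integers to integers, so the finer rank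
    determines the coarser one. *)
Lemma dyadic_nested i i' s t : (i <= i')%N ->
  dyadic_rank i' s = dyadic_rank i' t -> dyadic_rank i s = dyadic_rank i t.
Proof.
move=> ii' st; suff H m : (dyadic_rank i s <= m) = (dyadic_rank i t <= m).
  by apply/eqP; rewrite eq_le H lexx -H lexx.
have E u : (dyadic_rank i u <= m) = (dyadic_rank i' u <= m * 2 ^+ (i' - i)).
  rewrite !ceil_le_int intrM rmorphXn/= -(ler_pM2r (pow2_gt0 (i' - i))).
  by rewrite -mulrA -exprD subnKC.
by rewrite !E st.
Qed.

Lemma dyadic_length i j : dyadic_sup i j - dyadic_inf i j = 2 ^- i.
Proof. by rewrite /dyadic_sup /dyadic_inf -mulrBl -intrB subKr mul1r. Qed.

(** Among the dyadic intervals around a point that are good, take the longest;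
    two such intervals that meet are nested, hence equal by maximality. *)
Lemma whitney_decomposition (good : R -> R -> Prop) : exists a b : nat -> R,
  [/\ forall n, a n <= b n,
      forall n, a n < b n -> good (a n) (b n),
      disjoint_intervals setT a b &
      forall t, (exists2 r, 0 < r & forall c d, c < t <= d -> d - c < r -> good c d) ->
        exists n, a n < t <= b n].
Proof.
pose fine i t := good (dyadic_inf i (dyadic_rank i t)) (dyadic_sup i (dyadic_rank i t)).
pose maximal i j := exists t, [/\ dyadic_rank i t = j, fine i t &
  forall i', (i' < i)%N -> ~ fine i' t].
have maximal_unique i j i' j' t : maximal i j -> maximal i' j' ->
    dyadic_rank i t = j -> dyadic_rank i' t = j' -> (i = i') /\ (j = j').
  wlog ii' : i j i' j' / (i <= i')%N => [H|] M M' tj tj'.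
    have [ii'|/ltnW ii'] := leqP i i'; first exact: H.
    by have [-> ->] := H _ _ _ _ ii' M' M tj' tj.
  move: ii'; rewrite leq_eqVlt => /orP[/eqP ii'|ii'].
    by split=> //; rewrite -tj -tj' ii'.
  have [s [sj fs _]] := M; have [s' [sj' _ /(_ _ ii')[]]] := M'.
  by rewrite /fine (dyadic_nested (ltnW ii') (_ : _ = dyadic_rank i' t)) ?tj ?sj' //
     -sj.
pose ij n : nat * int := odflt (0%N, 0) (unpickle n).
pose act n := `[< pickle (ij n) = n /\ maximal (ij n).1 (ij n).2 >].
exists (fun n => if act n then dyadic_inf (ij n).1 (ij n).2 else 0).
exists (fun n => if act n then dyadic_sup (ij n).1 (ij n).2 else 0); split.
- move=> n; case: ifP => // _.
  by rewrite -subr_ge0 dyadic_length invr_ge0 ltW.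
- move=> n; case: ifP => [/asboolP[_ [t [tj ft _]]] _|_]; last by rewrite ltxx.
  by rewrite -tj.
- move=> n n' t _ _.
  case: ifPn => [/asboolP[n0 Mn]|_]; last by move=> /andP[/lt_le_trans h /h]; rewrite ltxx.
  case: ifPn => [/asboolP[n0' Mn']|_]; last first.
    by move=> _ /andP[/lt_le_trans h /h]; rewrite ltxx.
  rewrite !dyadicP => /eqP tn /eqP tn'.
  have [] := maximal_unique _ _ _ _ _ Mn Mn' tn tn'.
  move=> ei ej; apply: etrans (esym n0) (etrans _ n0'); congr pickle.
  by case: (ij n) (ij n') ei ej => [? ?] [? ?]/= -> ->.
- move=> t [r r0 goodr].
  have exi : exists i, `[< fine i t >].
    exists (Num.bound r^-1); apply/asboolP/goodr; first by rewrite dyadicP.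
    by rewrite dyadic_length invf_plt ?posrE//; exact: upper_nthrootP.
  case: (ex_minnP exi) => i /asboolP fi imin.
  exists (pickle (i, dyadic_rank i t)).
  have E : ij (pickle (i, dyadic_rank i t)) = (i, dyadic_rank i t).
    by rewrite /ij pickleK.
  suff -> : act (pickle (i, dyadic_rank i t)) by rewrite E dyadicP.
  apply/asboolP; rewrite E; split=> //; exists t; split=> // i' ii' fi'.
  by have := imin i' (asboolT fi'); rewrite leqNgt ii'.
Qed.

End whitney.

(** * Duality for compatible cuts *)

Section laminar_cuts.
Context {R : realType} {X : Type}.

Definition compatible_cuts (A B : X -> bool) : Prop :=
  [\/ forall x, A x -> ~~ B x, forall x, A x -> B x | forall x, B x -> A x].

Definition cut_metric n (S : nat -> X -> bool) (w : nat -> R) (x y : X) : R :=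
  \sum_(i < n) w i * (S i x != S i y)%:R.

(** Moving the two pairs across the cut [A] can only help: a cut compatible with
    [A] that separates two points on one side of [A] does not separate those on
    the other side, and it separates one of the crossing pairs. *)
Lemma cut_metric_cross n (S : nat -> X -> bool) (w : nat -> R) (A : X -> bool)
    x x' y y' :
  (forall i, (i < n)%N -> 0 <= w i) ->
  (forall i, (i < n)%N -> compatible_cuts (S i) A) ->
  A x -> A x' -> ~~ A y -> ~~ A y' ->
  cut_metric n S w x x' + cut_metric n S w y y' <=
  cut_metric n S w x y + cut_metric n S w x' y'.
Proof.
move=> w0 SA Ax Ax' Ay Ay'; rewrite -!big_split/=; apply: ler_sum => i _.
rewrite -!mulrDr ler_wpM2l ?w0// -!natrD ler_nat.
case: (SA i (ltn_ord i)) => [sub|sub|sub].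
- have F z : A z -> S i z = false by move=> Az; apply/negP => /sub; rewrite Az.
  by rewrite (F x)// (F x')//; case: (S i y) (S i y') => [] [].
- have F z : ~~ A z -> S i z = false by move=> Az; apply/negP => /sub; rewrite (negbTE Az).
  by rewrite (F y)// (F y')//; case: (S i x) (S i x') => [] [].
- by rewrite (sub x)// (sub x')//; case: (S i y) (S i y') => [] [].
Qed.

(** Kantorovich duality on a tree: a function that is 1-Lipschitz for a sum of
    compatible cuts is a combination of the cuts with coefficients bounded by
    the weights.  The last cut is split off first: its coefficient [s] has to
    lie in a family of intervals, which meet pairwise by [cut_metric_cross]. *)
Lemma laminar_duality n (S : nat -> X -> bool) (w : nat -> R) (g : X -> R) :
  (forall i, (i < n)%N -> 0 <= w i) ->
  (forall i j, (i < n)%N -> (j < n)%N -> compatible_cuts (S i) (S j)) ->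
  (forall x y, `|g x - g y| <= cut_metric n S w x y) ->
  exists2 c : nat -> R, forall i, (i < n)%N -> `|c i| <= w i &
    forall x y, g x - g y = \sum_(i < n) c i * ((S i x)%:R - (S i y)%:R).
Proof.
elim: n g => [g _ _ gd|n IH g w0 lam gd].
  exists (fun=> 0) => // x y; rewrite big_ord0.
  by have := gd x y; rewrite /cut_metric big_ord0 normr_le0 => /eqP.
have dE x y : cut_metric n.+1 S w x y =
    cut_metric n S w x y + w n * (S n x != S n y)%:R by rewrite /cut_metric big_ord_recr.
have ltS i : (i < n)%N -> (i < n.+1)%N by move=> /ltnW.
pose P : set R := [set r | r = - w n \/ exists x y,
  [/\ S n x, ~~ S n y & r = g x - g y - cut_metric n S w x y]].
have wn := w0 n (leqnn _).
have d_ge0 x y : 0 <= cut_metric n S w x y.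
  by apply: sumr_ge0 => i _; rewrite mulr_ge0// w0// ltS.
have P_le_w r : P r -> r <= w n.
  move=> [->|[x [y [Sx Sy ->]]]]; first lra.
  have := gd x y; rewrite dE Sx (negbTE Sy)/= mulr1 ler_norml => /andP[_]; lra.
have P_le_pair x y : S n x -> ~~ S n y ->
    forall r, P r -> r <= g x - g y + cut_metric n S w x y.
  move=> Sx Sy r [->|[x' [y' [Sx' Sy' ->]]]].
    have := gd x y; rewrite dE Sx (negbTE Sy)/= mulr1 ler_norml => /andP[]; lra.
  have cross := cut_metric_cross (fun i ni => w0 i (ltS _ ni))
    (fun i ni => lam i n (ltS _ ni) (leqnn _)) Sx' Sx Sy' Sy.
  have := gd x' x; rewrite dE Sx Sx'/= mulr0 ler_norml => /andP[_].
  have := gd y' y; rewrite dE (negbTE Sy) (negbTE Sy')/= mulr0 ler_norml => /andP[].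
  lra.
have PP : has_ubound P by exists (w n).
have P0 : P !=set0 by exists (- w n); left.
pose s := sup P.
have sw : `|s| <= w n.
  rewrite ler_norml; apply/andP; split; first by apply: sup_ubP => //; left.
  by apply: ge_sup.
have g'd x y : `|(g x - s * (S n x)%:R) - (g y - s * (S n y)%:R)| <=
    cut_metric n S w x y.
  wlog Sxy : x y / S n y -> S n x.
    move=> H; have [] := boolP (S n y ==> S n x) => [/implyP/H//|].
    rewrite negb_imply => /andP[Sy Sx].
    have := H y x; rewrite distrC /cut_metric; under eq_bigr do rewrite eq_sym.
    by apply; rewrite Sy.
  have := gd x y; rewrite dE.
  have [Sx|Sx] := boolP (S n x); last first.
    by rewrite (contraNF Sxy Sx)/= !mulr0 !subr0 addr0.
  have [Sy|Sy] /= := boolP (S n y).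
    rewrite mulr0 addr0 => gxy.
    by have -> : g x - s * 1 - (g y - s * 1) = g x - g y by lra.
  move=> _; rewrite mulr1 mulr0 subr0 ler_norml.
  have : g x - g y - cut_metric n S w x y <= s.
    by apply: sup_ubP => //; right; exists x, y.
  have : s <= g x - g y + cut_metric n S w x y.
    by apply: ge_sup => // r; exact: P_le_pair.
  by move=> *; apply/andP; split; lra.
have [c cw cE] := IH _ (fun i ni => w0 i (ltS _ ni))
  (fun i j ni nj => lam i j (ltS _ ni) (ltS _ nj)) g'd.
exists (fun i => if (i < n)%N then c i else s) => [i|x y].
  by rewrite ltnS leq_eqVlt; case: ltnP => [/cw//|ni /orP[/eqP ->//|]].
rewrite big_ord_recr/= ltnn; under eq_bigr do rewrite ltn_ord.
rewrite -cE; lra.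
Qed.

End laminar_cuts.

(** * Gromov products and the four-point condition *)

Section gromov.
Context {R : realType} {M : metricType R}.
Implicit Types x y z u v : M.

Definition four_point : Prop := forall x y u v,
  mdist x y + mdist u v <= Num.max (mdist x u + mdist y v) (mdist x v + mdist y u).

Definition gromov (x0 x y : M) : R := (mdist x x0 + mdist y x0 - mdist x y) / 2.

(** The heights of the points of [M] on the segment from [x0] to [z]. *)
Definition heights_on x0 z : set R :=
  [set t | exists y, mdist y x0 = t /\ gromov x0 z y = t].

Lemma gromovC x0 x y : gromov x0 x y = gromov x0 y x.
Proof. by rewrite /gromov (metric_sym x y) addrC [in LHS](addrC (mdist x x0)) addrC. Qed.

Lemma gromovxx x0 x : gromov x0 x x = mdist x x0.
Proof. rewrite /gromov mdistxx; lra. Qed.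

Lemma gromov_ge0 x0 x y : 0 <= gromov x0 x y.
Proof.
rewrite /gromov; have := metric_triangle x x0 y; rewrite (metric_sym x0 y); lra.
Qed.

Lemma gromov_lel x0 x y : gromov x0 x y <= mdist x x0.
Proof.
rewrite /gromov; have := metric_triangle y x x0; rewrite (metric_sym y x); lra.
Qed.

Lemma gromov_ler x0 x y : gromov x0 x y <= mdist y x0.
Proof. by rewrite gromovC gromov_lel. Qed.

(** The four-point condition with the base point as one of the points. *)
Lemma gromov_ultra : four_point -> forall x0 x y z,
  Num.min (gromov x0 x y) (gromov x0 y z) <= gromov x0 x z.
Proof.
move=> H x0 x y z; have := H x z y x0; rewrite /gromov.
rewrite (metric_sym z y); rewrite maxEle minEle.
by case: ifP; case: ifP; lra.
Qed.

(** In an ultrametric product the two smallest values of a triple agree. *)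
Lemma gromov_lt_eq : four_point -> forall x0 x y z,
  gromov x0 y z < gromov x0 x z -> gromov x0 x y = gromov x0 y z.
Proof.
move=> H x0 x y z lt.
have := gromov_ultra H x0 x z y; have := gromov_ultra H x0 y x z.
rewrite (gromovC x0 z y) (gromovC x0 y x) !minEle.
by case: ifP; case: ifP; lra.
Qed.

End gromov.
Arguments four_point {R} M.

(** An ultrametric product need not come from a distance here; for the Gromov
    product this extends the four-point condition from quadruples that contain
    the base point to all quadruples. *)
Lemma ultrametric_four_point (R : realType) (T : Type) (m : T -> T -> R) :
  (forall x y, m x y = m y x) ->
  (forall x y z, Num.min (m x y) (m y z) <= m x z) ->
  forall x y u v, Num.min (m x u + m y v) (m x v + m y u) <= m x y + m u v.
Proof.
move=> mC mU x y u v.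
wlog xyuv : x y u v / m x y <= m u v.
  move=> H; have [/H//|/ltW/H] := leP (m x y) (m u v).
  by rewrite (addrC (m x y)) (mC x u) (mC y v) (mC x v) (mC y u) (addrC (m v x)).
have U a b c : m a b <= m a c \/ m b c <= m a c.
  by have := mU a b c; rewrite ge_min => /orP.
have H1 := U x u y; have H2 := U x v y; have H3 := U u x v; have H4 := U u y v.
move: H1 H2 H3 H4; rewrite ?(mC u x) ?(mC u y) ?(mC v x) ?(mC v y) ge_min.
move=> H1 H2 H3 H4; apply/orP.
have [|ge1] := leP (m x u + m y v) (m x y + m u v); first by left.
right; move: H1 H2 H3 H4 => [] ? [] ? [] ? [] ?; lra.
Qed.

(** * From R-trees to the four-point condition *)

Section paths.
Context {R : realType} {T : metricType R}.
Implicit Types (x y z p : T) (g : R -> T) (c e s t : R).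

(** The 1-Lipschitz paths are the ones that concatenate; a 1-Lipschitz path whose
    endpoints are as far apart as possible is geodesic ([short_geodesic]). *)
Definition short_path g c : Prop := forall s t, 0 <= s -> s <= t -> t <= c ->
  mdist (g s) (g t) <= t - s.

Definition geodesic_path g c : Prop := forall s t, 0 <= s -> s <= t -> t <= c ->
  mdist (g s) (g t) = t - s.

Definition concat c g1 g2 : R -> T := fun t => if t <= c then g1 t else g2 (t - c).

Lemma concatl c g1 g2 t : t <= c -> concat c g1 g2 t = g1 t.
Proof. by rewrite /concat => ->. Qed.

Lemma concatr c g1 g2 t : g1 c = g2 0 -> c <= t -> concat c g1 g2 t = g2 (t - c).
Proof.
move=> g12; rewrite /concat le_eqVlt => /orP[/eqP <-|ct]; first by rewrite lexx subrr.
by rewrite leNgt ct.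
Qed.

Lemma short_concat c e g1 g2 : 0 <= c -> 0 <= e -> g1 c = g2 0 ->
  short_path g1 c -> short_path g2 e -> short_path (concat c g1 g2) (c + e).
Proof.
move=> c0 e0 g12 h1 h2 s t s0 st tce.
have [tc|ct] := leP t c.
  by rewrite !concatl//; [exact: h1|exact: le_trans tc].
rewrite (concatr g12 (ltW ct)); have [sc|cs] := leP s c.
  rewrite concatl//; apply: le_trans (metric_triangle _ (g1 c) _) _.
  rewrite [X in _ + mdist X _]g12.
  have := h1 s c s0 sc (lexx _); have := h2 0 (t - c) (lexx _).
  by move=> h2' h1'; have := h2' ltac:(lra) ltac:(lra); lra.
rewrite (concatr g12 (ltW cs)); have := h2 (s - c) (t - c); lra.
Qed.

Lemma short_geodesic g c : 0 <= c -> short_path g c -> mdist (g 0) (g c) = c ->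
  geodesic_path g c.
Proof.
move=> c0 h gc s t s0 st tc; apply/eqP; rewrite eq_le h//=.
have := metric_triangle (g 0) (g s) (g c); have := metric_triangle (g s) (g t) (g c).
have := h 0 s (lexx _) s0 (le_trans st tc); have := h t c (le_trans s0 st) tc (lexx _).
rewrite gc; lra.
Qed.

Lemma geodesic_short g c : geodesic_path g c -> short_path g c.
Proof. by move=> h s t *; rewrite h. Qed.

Lemma geodesic_inj g c s t : geodesic_path g c -> 0 <= s <= c -> 0 <= t <= c ->
  g s = g t -> s = t.
Proof.
move=> h; wlog st : s t / s <= t.
  by move=> H; have [/H//|/ltW/H h1 h2 h3 /esym/h1->] := leP s t.
move=> /andP[s0 sc] /andP[t0 tc] gst; have := h s t s0 st tc.
rewrite gst mdistxx; lra.
Qed.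

Lemma short_path_arc g c : 0 < c -> short_path g c ->
  (forall s t, 0 <= s <= c -> 0 <= t <= c -> g s = g t -> s = t) ->
  is_arc (g 0) (g c) (g @` `[0, c]).
Proof.
move=> c0 h gi; exists (fun t => g (t * c)).
have mem t : 0 <= t <= 1 -> 0 <= t * c <= c.
  by move=> /andP[t0 t1]; rewrite mulr_ge0 ?(ltW c0)//= ler_piMl// ltW.
split.
- apply/subspace_continuousP => s; rewrite /= in_itv/= => s01.
  apply/cvg_ballP => e e0; rewrite near_withinE.
  exists (e / c) => /=; first by rewrite divr_gt0.
  move=> t /=; rewrite ltr_pdivlMr// in_itv/= => ste t01.
  rewrite ballEmdist/=; apply: le_lt_trans ste.
  wlog st : s t s01 t01 / s <= t.
    move=> H; have [/H|/ltW/H h1] := leP s t; first exact.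
    by rewrite metric_sym distrC; exact: h1.
  have /andP[s0 _] := mem s s01; have /andP[_ t1] := mem t t01.
  rewrite distrC ger0_norm ?subr_ge0// mulrBl; apply: h => //.
  by rewrite ler_wpM2r// ltW.
- move=> s t; rewrite !inE/= !in_itv/= => /mem ms /mem mt /gi.
  by move=> /(_ ms mt)/(mulIf (lt0r_neq0 c0)).
- by rewrite mul0r.
- by rewrite mul1r.
- apply/seteqP; split=> [_ [t + <-]|_ [t + <-]]; rewrite /= in_itv/=.
    by move=> /mem tc; exists (t * c).
  move=> /andP[t0 tc]; exists (t / c); last by rewrite divfK// lt0r_neq0.
  by rewrite /= in_itv/= divr_ge0 ?(ltW c0)//= ler_pdivrMr// mul1r.
Qed.

End paths.

Section rtree_theory.
Context {R : realType} {T : metricType R}.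
Implicit Types (x y z p : T) (g : R -> T) (c e s t : R).
Hypothesis treeT : rtree [set: T].

(** By uniqueness any arc is the segment with the same endpoints, so the isometry
    of the segment, reflected if necessary, parametrizes it from [x]. *)
Lemma rtree_arc x y I : x <> y -> is_arc x y I -> exists g,
  [/\ g 0 = x, g (mdist x y) = y, geodesic_path g (mdist x y) &
      g @` `[0, mdist x y] = I].
Proof.
move=> xy arcI; have [J [_ _ uniq [phi0 [isoJ imJ]]]] := treeT Logic.I Logic.I xy.
move: isoJ imJ; rewrite -(uniq I)// => {J uniq} iso0 im0.
have [Ix Iy] : I x /\ I y.
  have [g [_ _ <- <- <-]] := arcI.
  by split; [exists 0|exists 1]; rewrite //= in_itv/= lexx ler01.
have d0 : 0 < mdist x y by rewrite mdist_gt0; exact/eqP.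
(* the endpoints of the arc are as far apart as those of the interval, so [phi0]
   maps [x] to one end of the interval; reflect it if this is not 0 *)
have [phi [iso im phix]] : exists phi : T -> R^o, [/\ isometry_on I phi,
    phi @` I = `[0, mdist x y]%classic & phi x = 0].
  have bnd p : I p -> 0 <= phi0 p <= mdist x y.
    by move=> Ip; have : `[0, mdist x y]%classic (phi0 p);
      [rewrite -im0; exists p|rewrite /= in_itv].
  have [x0|x0] := eqVneq (phi0 x) 0; first by exists phi0.
  have phixE : phi0 x = mdist x y.
    have := iso0 _ _ Ix Iy; rewrite {1}/mdist/=.
    have /andP[] := bnd _ Ix; have /andP[] := bnd _ Iy.
    have [h|h] := leP (phi0 x) (phi0 y).
      rewrite ger0_norm ?subr_ge0// => *; exfalso; move/eqP: x0; apply; lra.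
    rewrite ltr0_norm ?subr_lt0//; lra.
  exists (fun p => mdist x y - phi0 p); split; last by rewrite phixE subrr.
  - move=> p q Ip Iq; rewrite -(iso0 _ _ Ip Iq) /mdist/=.
    by rewrite opprD opprK addrACA subrr add0r addrC distrC.
  - apply/seteqP; split=> [_ [p /bnd + <-]|t].
      by rewrite /= in_itv/=; move=> *; lra.
    rewrite /= in_itv/= => t0d.
    have : `[0, mdist x y]%classic (mdist x y - t) by rewrite /= in_itv/=; lra.
    by rewrite -im0 => -[p Ip pt]; exists p => //; rewrite pt subKr.
have /choice[g gP] : forall t, exists p, 0 <= t <= mdist x y -> I p /\ phi p = t.
  move=> t; have [tI|tI] := boolP (0 <= t <= mdist x y); last by exists x.
  have : `[0, mdist x y]%classic t by rewrite /= in_itv.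
  by rewrite -im => -[p Ip pt]; exists p.
have phiI p : I p -> phi p = mdist x p.
  by move=> Ip; exact: (segment_chartP Ix iso im phix).
have I_inj p q : I p -> I q -> phi p = phi q -> p = q.
  move=> Ip Iq pq; apply: mdist_positivity.
  by rewrite -(iso _ _ Ip Iq) /mdist/= pq subrr normr0.
have I0 : (0 : R) <= 0 <= mdist x y by apply/andP; split => //; exact: ltW.
have I1 : 0 <= mdist x y <= mdist x y by apply/andP; split => //; exact: ltW.
exists g; split.
- by have [? ?] := gP 0 I0; apply: I_inj => //; rewrite phix.
- by have [? ?] := gP _ I1; apply: I_inj => //; rewrite (phiI y).
- move=> s t s0 st td.
  have [Is ps] : I (g s) /\ phi (g s) = s by apply: gP; rewrite s0 (le_trans st).
  have [It pt] : I (g t) /\ phi (g t) = t by apply: gP; rewrite td (le_trans s0).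
  by rewrite -(iso _ _ Is It) /mdist/= ps pt ger0_norm// subr_ge0.
- apply/seteqP; split=> [_ [t + <-]|p Ip].
    by rewrite /= in_itv/= => /gP[].
  have : `[0, mdist x y]%classic (phi p) by rewrite -im; exists p.
  move=> pI; exists (phi p) => //; move: pI; rewrite /= in_itv/= => /gP[? ?].
  exact: I_inj.
Qed.

Lemma rtree_geodesic x y : exists g,
  [/\ g 0 = x, g (mdist x y) = y & geodesic_path g (mdist x y)].
Proof.
have [->|/eqP xy] := eqVneq x y; last first.
  have [I [_ arcI _ _]] := treeT Logic.I Logic.I xy.
  by have [g []] := rtree_arc xy arcI; exists g.
exists (fun=> y); split=> // s t; rewrite !mdistxx; lra.
Qed.

(** Uniqueness of arcs: an injective 1-Lipschitz path covers the same points as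
    the geodesic with the same endpoints, so it goes through points between
    these. *)
Lemma short_path_between g c x y t : 0 <= c -> short_path g c ->
  (forall s t, 0 <= s <= c -> 0 <= t <= c -> g s = g t -> s = t) ->
  g 0 = x -> g c = y -> 0 <= t <= c ->
  mdist x (g t) + mdist (g t) y = mdist x y.
Proof.
move=> c0 h gi g0 gc tc.
have cp : 0 < c \/ t = c by move: c0; rewrite le_eqVlt => /orP[/eqP|]; lra.
case: cp => [cp|->]; last by rewrite gc mdistxx addr0.
have arc : is_arc x y (g @` `[0, c]) by rewrite -g0 -gc; exact: short_path_arc.
have xy : x <> y by rewrite -g0 -gc => /gi; rewrite !lexx c0 => /(_ isT isT) c0'; move: cp; rewrite -c0' ltxx.
have [g' [g'0 g'1 geo im]] := rtree_arc xy arc.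
have : (g @` `[0, c]) (g t) by exists t => //=; rewrite in_itv.
rewrite -im => -[s]; rewrite /= in_itv/= => /andP[s0 s1] <-.
have := geo 0 s (lexx _) s0 s1; have := geo s (mdist x y) s0 s1 (lexx _).
by rewrite g'0 g'1 => -> ->; lra.
Qed.

(** The geodesics from [x] to [p] and from [p] to [y] concatenate to a geodesic,
    hence to the unique arc. *)
Lemma between_on_arc x y p I : x <> y -> is_arc x y I ->
  mdist x p + mdist p y = mdist x y -> I p.
Proof.
move=> xy arcI bet; have [g1 [g10 g1p geo1]] := rtree_geodesic x p.
have [g2 [g20 g2y geo2]] := rtree_geodesic p y.
have g12 : g1 (mdist x p) = g2 0 by rewrite g1p g20.
pose g := concat (mdist x p) g1 g2.
have [xp py] : 0 <= mdist x p /\ 0 <= mdist p y by rewrite !mdist_ge0.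
have gxp : g (mdist x p) = p by rewrite /g concatl.
have gx : g 0 = x by rewrite /g concatl.
have gy : g (mdist x y) = y by rewrite /g concatr// -bet ?lerDl// addrC addKr.
have short : short_path g (mdist x y).
  by rewrite -bet; apply: short_concat => //; exact: geodesic_short.
have geo : geodesic_path g (mdist x y).
  by apply: short_geodesic => //; rewrite ?mdist_ge0// gx gy.
have arc : is_arc x y (g @` `[0, mdist x y]).
  have d0 : 0 < mdist x y by rewrite mdist_gt0; exact/eqP.
  have := short_path_arc d0 short (fun s t hs ht => geodesic_inj geo hs ht).
  by rewrite gx gy.
have [J [_ _ uniq _]] := treeT Logic.I Logic.I xy.
rewrite (uniq I)// -(uniq _ _ arc)//.
by exists (mdist x p) => //=; rewrite in_itv/= xp -bet lerDl.
Qed.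

Lemma between_inj x y p q : mdist x p + mdist p y = mdist x y ->
  mdist x q + mdist q y = mdist x y -> mdist x p = mdist x q -> p = q.
Proof.
have [<-|/eqP xy] := eqVneq x y.
  rewrite mdistxx => bp bq _; have := mdist_ge0 x p; have := mdist_ge0 x q.
  have := mdist_ge0 p x; have := mdist_ge0 q x => *.
  have xp : mdist x p = 0 by lra.
  have xq : mdist x q = 0 by lra.
  by rewrite -(mdist_positivity _ _ xp) -(mdist_positivity _ _ xq).
have [I [_ arcI _ _]] := treeT Logic.I Logic.I xy.
move=> /(between_on_arc xy arcI) Ip /(between_on_arc xy arcI) Iq.
have [g [g0 g1 geo im]] := rtree_arc xy arcI.
move: Ip Iq; rewrite -im => -[s + <-] [t + <-]; rewrite /= !in_itv/=.
move=> /andP[s0 s1] /andP[t0 t1].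
by rewrite -[in mdist x (g s)]g0 -[in mdist x (g t)]g0 !geo// !subr0 => ->.
Qed.

(** The two geodesics from [x0] to [x] and [y] separate at [z], and the path
    from [x] to [z] to [y] along them is injective, hence an arc. *)
Lemma rtree_tripod x0 x y : exists z,
  [/\ mdist x0 z + mdist z x = mdist x0 x, mdist x0 z + mdist z y = mdist x0 y &
      mdist x z + mdist z y = mdist x y].
Proof.
have [gx [gx0 gx1 geox]] := rtree_geodesic x0 x.
have [gy [gy0 gy1 geoy]] := rtree_geodesic x0 y.
set hx := mdist x0 x in gx1 geox *; set hy := mdist x0 y in gy1 geoy *.
have [hx0 hy0] : 0 <= hx /\ 0 <= hy by rewrite !mdist_ge0.
pose S : set R := [set t | [/\ 0 <= t, t <= hx, t <= hy & gx t = gy t]].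
have S0 : S 0 by split=> //; rewrite gx0 gy0.
have Sub : has_ubound S by exists hx => t [].
set c := sup S; have c0 : 0 <= c by exact: sup_ubP.
have chx : c <= hx by apply: ge_sup => [|t []//]; exists 0.
have chy : c <= hy by apply: ge_sup => [|t []//]; exists 0.
have gc : gx c = gy c.
  apply: mdist_positivity; apply/eqP; rewrite eq_le mdist_ge0 andbT.
  apply/ler_addgt0Pr => e e0; rewrite add0r.
  have e2 : 0 < e / 2 by rewrite divr_gt0.
  have [t St tc] := @sup_adherent R S (e / 2) e2 (conj (ex_intro _ _ S0) Sub).
  have tc' : t <= c by exact: sup_ubP.
  case: St => t0 tx ty gt; have := metric_triangle (gx c) (gx t) (gy c).
  rewrite (metric_sym (gx c) (gx t)) (geox t c)// gt (geoy t c)//.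
  by rewrite -/c in tc; lra.
exists (gx c).
have x0c : mdist x0 (gx c) = c by rewrite -gx0 geox// subr0.
have cx : mdist (gx c) x = hx - c by rewrite -[in X in mdist _ X = _]gx1 geox.
have cy : mdist (gx c) y = hy - c by rewrite gc -[in X in mdist _ X = _]gy1 geoy.
split; [lra|lra|].
pose g := concat (hx - c) (fun t => gx (hx - t)) (fun t => gy (c + t)).
have g12 : gx (hx - (hx - c)) = gy (c + 0) by rewrite subKr addr0.
have gcE : g (hx - c) = gx c by rewrite /g concatl// subKr.
have gxE : g 0 = x by rewrite /g concatl ?subr_ge0// subr0.
have gyE : g (hx - c + (hy - c)) = y.
  rewrite /g concatr ?lerDl ?subr_ge0//.
  by have -> : c + (hx - c + (hy - c) - (hx - c)) = hy by lra.
have sh : short_path g (hx - c + (hy - c)).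
  apply: short_concat; rewrite ?subr_ge0// => s t s0 st tc.
    by rewrite metric_sym geox; lra.
  by rewrite geoy; lra.
rewrite -gcE; apply: (short_path_between (c := hx - c + (hy - c)) _ sh) => //.
- by rewrite addr_ge0// subr_ge0.
- move=> s t; wlog st : s t / s <= t.
    move=> H; have [st|/ltW ts] := leP s t; first exact: H.
    by move=> hs ht /esym gst; rewrite (H t s).
  move=> /andP[s0 sc] /andP[t0 tc]; rewrite /g.
  have [tl|tr] := leP t (hx - c).
    rewrite !concatl ?(le_trans st)// => /(geodesic_inj geox); lra.
  rewrite (concatr g12 (ltW tr)); have [sl|sr] := leP s (hx - c); last first.
    rewrite (concatr g12 (ltW sr)) => /(geodesic_inj geoy); lra.
  rewrite concatl// => gst.
  have h1 : mdist x0 (gx (hx - s)) = hx - s by rewrite -gx0 geox; lra.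
  have h2 : mdist x0 (gy (c + (t - (hx - c)))) = c + (t - (hx - c)).
    by rewrite -gy0 geoy; lra.
  have e : hx - s = c + (t - (hx - c)) by rewrite -h1 -h2 gst.
  suff : hx - s <= c by lra.
  apply: sup_ubP => //; split; [lra|lra|lra|].
  by rewrite gst e.
- by rewrite subr_ge0 chx/= lerDl subr_ge0.
Qed.

(** The Gromov product of two points is the height of the point where their
    segments to the base point separate.  It is ultrametric because two segments
    that both agree with a third one up to some height agree with each other up
    to that height. *)
Lemma rtree_four_point : four_point T.
Proof.
move=> x0 x y z.
pose m p q := gromov x0 p q.
have mE p q : exists r, [/\ mdist x0 r + mdist r p = mdist x0 p,
    mdist x0 r + mdist r q = mdist x0 q & mdist x0 r = m p q].
  have [r [h1 h2 h3]] := rtree_tripod x0 p q; exists r; split=> //.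
  rewrite /m /gromov (metric_sym p x0) (metric_sym q x0).
  have := metric_sym p r; lra.
have at_height p t : 0 <= t <= mdist x0 p -> exists r,
    mdist x0 r = t /\ mdist x0 r + mdist r p = mdist x0 p.
  move=> /andP[t0 tp]; have [g [g0 g1 geo]] := rtree_geodesic x0 p.
  have h0 := geo 0 t (lexx _) t0 tp; have h1 := geo t _ t0 tp (lexx _).
  by exists (g t); rewrite g0 in h0; rewrite g1 in h1; lra.
have mU p q r : Num.min (m p q) (m q r) <= m p r.
  set t := Num.min _ _.
  have t0 : 0 <= t by rewrite le_min !gromov_ge0.
  have [u [up uq um]] := mE p q; have [v [vq vr vm]] := mE q r.
  have tu : t <= mdist x0 u by rewrite um ge_min lexx.
  have tv : t <= mdist x0 v by rewrite vm ge_min lexx orbT.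
  have [a [at_ au]] : exists r, mdist x0 r = t /\ mdist x0 r + mdist r u = mdist x0 u.
    by apply: at_height; rewrite t0.
  have [b [bt bv]] : exists r, mdist x0 r = t /\ mdist x0 r + mdist r v = mdist x0 v.
    by apply: at_height; rewrite t0.
  have aq : mdist x0 a + mdist a q = mdist x0 q.
    have := metric_triangle x0 a q; have := metric_triangle a u q; lra.
  have bq : mdist x0 b + mdist b q = mdist x0 q.
    have := metric_triangle x0 b q; have := metric_triangle b v q; lra.
  have ab : a = b by apply: (between_inj aq bq); lra.
  rewrite -ab in bv bq bt => {b ab}.
  have := metric_triangle p a r; rewrite (metric_sym p a).
  have := metric_triangle a u p; have := metric_triangle a v r.
  rewrite /m /gromov (metric_sym p x0) (metric_sym r x0); lra.
have := @ultrametric_four_point R T m (gromovC x0) mU x0 x y z.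
rewrite /m /gromov !mdistxx.
rewrite (metric_sym y x0) (metric_sym x x0) (metric_sym z x0).
rewrite minEle maxEle; case: ifP; case: ifP; lra.
Qed.

End rtree_theory.

(** * From the four-point condition to R-trees *)

Section pseudometric_quotient.
Context {R : realType} {P : choiceType}.

Record pseudodist := Pseudodist {
  pdist :> P -> P -> R ;
  pdistxx : forall p, pdist p p = 0 ;
  pdistC : forall p q, pdist p q = pdist q p ;
  pdist_triangle : forall q p r, pdist p r <= pdist p q + pdist q r }.

Variable D : pseudodist.

Lemma pdist_ge0 p q : 0 <= D p q.
Proof.
have := pdist_triangle D q p p; rewrite pdistxx (pdistC D q p); lra.
Qed.

Definition repr_pt (p : P) : P := xget p [set q | D p q = 0].

Lemma repr_ptP p : D p (repr_pt p) = 0.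
Proof. by rewrite /repr_pt; case: xgetP => //= _; rewrite pdistxx. Qed.

Lemma repr_pt_eq p q : D p q = 0 -> repr_pt p = repr_pt q.
Proof.
move=> pq; have E : [set r | D p r = 0] = [set r | D q r = 0].
  apply/funext => r /=; apply/propext; have := pdist_ge0 p r; have := pdist_ge0 q r.
  have := pdist_triangle D q p r; have := pdist_triangle D p q r.
  rewrite (pdistC D q p) pq => *; split=> *; lra.
rewrite /repr_pt E /xget; case: pselect => // -[].
by exists q; apply/asboolP; rewrite /= pdistxx.
Qed.

(** The points are canonical representatives of the classes of points at distance
    0, which makes points at distance 0 equal. *)
Record mquot := MQuot { mquot_val :> P ; _ : repr_pt mquot_val == mquot_val }.

HB.instance Definition _ := [isSub for mquot_val].
HB.instance Definition _ := [Choice of mquot by <:].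

Let dist (p q : mquot) := D p q.

Lemma mquot_dist0 (p q : mquot) : dist p q = 0 -> p = q.
Proof.
move=> /repr_pt_eq pq; apply/val_inj.
by case: p q pq => [p /eqP pE] [q /eqP qE] /=; rewrite pE qE.
Qed.

HB.instance Definition _ := @isMetric.Build R mquot dist
  (fun p => pdistxx D p) mquot_dist0 (fun p q => pdistC D p q)
  (fun q p r => pdist_triangle D q p r).

Lemma mclass_subproof p : repr_pt (repr_pt p) == repr_pt p.
Proof. by apply/eqP/esym/repr_pt_eq; rewrite repr_ptP. Qed.

Definition mclass (p : P) : mquot := MQuot (mclass_subproof p).

Lemma mdist_mclass p q : mdist (mclass p) (mclass q) = D p q.
Proof.
have -> : mdist (mclass p) (mclass q) = D (repr_pt p) (repr_pt q) by [].
have := pdist_triangle D (repr_pt p) p q; have := pdist_triangle D (repr_pt q) (repr_pt p) q.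
have := pdist_triangle D p (repr_pt p) (repr_pt q).
have := pdist_triangle D q p (repr_pt q).
rewrite (pdistC D (repr_pt p) p) (pdistC D (repr_pt q) q) !repr_ptP; lra.
Qed.

Lemma mclass_surj (z : mquot) : exists p, z = mclass p.
Proof.
exists (z : P); apply: mquot_dist0.
by have := repr_ptP (mquot_val z).
Qed.

End pseudometric_quotient.

Section geodesic_four_point.
Context {R : realType} {T : metricType R}.
Implicit Types (x y z p : T) (g : R -> T) (c e s t : R).

Lemma open_mdist (A : set T) :
  (forall p, A p -> exists2 e : R, 0 < e & forall q, mdist p q < e -> A q) -> open A.
Proof.
move=> H; rewrite openE => p /H[e e0 eA]; apply/nbhs_ballP; exists e => // q.
by rewrite ballEmdist; exact: eA.
Qed.

Lemma arc_connected x y (I : set T) : is_arc x y I -> connected I.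
Proof.
move=> [g [gc _ _ _ <-]].
by apply: connected_continuous_connected gc; exact: segment_connected.
Qed.

Hypothesis fpT : four_point T.

(** The points [w] with [p] on the geodesic from [x] to [w] form, apart from
    [p], an open and closed subset of the complement of [p]: hence [p]
    separates [x] from [y]. *)
Lemma between_sub_arc x y p J : is_arc x y J ->
  mdist x p + mdist p y = mdist x y -> J p.
Proof.
move=> arcJ bet; apply: contrapT => nJp.
have [Jx Jy] : J x /\ J y.
  have [g [_ _ <- <- <-]] := arcJ.
  by split; [exists 0|exists 1]; rewrite //= in_itv/= lexx ler01.
have px : 0 < mdist x p by rewrite mdist_gt0; apply/eqP => px; apply: nJp; rewrite -px.
have py : 0 < mdist y p by rewrite mdist_gt0; apply/eqP => py; apply: nJp; rewrite -py.
pose V : set T := [set w | mdist x p + mdist p w = mdist x w /\ w <> p].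
pose U : set T := [set w | mdist x w < mdist x p + mdist p w].
have oV : open V.
  apply: open_mdist => w [wp /eqP wNp]; exists (mdist w p); first by rewrite mdist_gt0.
  move=> w' ww'; split; last by move=> w'p; rewrite w'p ltxx in ww'.
  have := fpT x w p w'; rewrite (metric_sym w p) => fp.
  have := metric_triangle x p w'; rewrite (metric_sym w p) in ww'.
  have := mdist_ge0 p w'; move: fp; rewrite maxEle; case: ifP; lra.
have oU : open U.
  apply: open_mdist => w; rewrite /U/= => wU.
  exists ((mdist x p + mdist p w - mdist x w) / 2); first lra.
  move=> w' ww'; have := metric_triangle x w w'; have := metric_triangle p w' w.
  rewrite (metric_sym w' w); lra.
have := arc_connected arcJ; move=> /(_ (J `&` V)) cJ.
have : J `&` V = J.
  apply: cJ.
  - by exists y; split=> //; split=> // yp; rewrite yp mdistxx ltxx in py.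
  - by exists V.
  - exists (~` U); first by rewrite closedC.
    apply/seteqP; split=> w [Jw].
      by move=> [wp _]; split=> //; rewrite /U/= wp ltxx.
    move=> /negP; rewrite -leNgt => h; split=> //; split.
      by apply/eqP; rewrite eq_le h metric_triangle.
    by move=> wp; apply: nJp; rewrite -wp.
move=> JV; have : (J `&` V) x by rewrite JV.
by move=> [_ [+ _]]; rewrite mdistxx (metric_sym p x); lra.
Qed.

(** A point [q] of [J] outside [I] would cut [J], hence also [I], into two parts
    closed in [I] and containing one endpoint each. *)
Lemma arc_sub x y I J : is_arc x y I -> is_arc x y J -> I `<=` J -> J `<=` I.
Proof.
move=> arcI arcJ IJ q Jq; apply: contrapT => nIq.
have [Ix Iy] : I x /\ I y.
  have [g [_ _ <- <- <-]] := arcI.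
  by split; [exists 0|exists 1]; rewrite //= in_itv/= lexx ler01.
have cI := arc_connected arcI.
have [f [fc fi f0 f1 fJ]] := arcJ.
have {fi}inj s t : 0 <= s <= 1 -> 0 <= t <= 1 -> f s = f t -> s = t.
  by move=> hs ht; apply: fi; rewrite inE/= in_itv.
move: Jq; rewrite -fJ => -[t]; rewrite /= in_itv/= => /andP[t0 t1] ftq.
have closed_im a b : 0 <= a -> b <= 1 -> closed (f @` `[a, b]).
  move=> a0 b1; apply: compact_closed; first exact: metric_hausdorff.
  apply: continuous_compact; last exact: segment_compact.
  apply: continuous_subspaceW fc => s; rewrite /= !in_itv/= => /andP[as_ sb].
  by rewrite (le_trans a0)//= (le_trans sb).
have memI p : I p -> exists2 s, 0 <= s <= 1 & f s = p.
  by move=> /IJ; rewrite -fJ => -[s]; rewrite /= in_itv/= => *; exists s.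
have : I `&` f @` `[0, t] = I.
  apply: cI.
  - by exists x; split=> //; exists 0; rewrite //= in_itv/= lexx t0.
  - exists (~` (f @` `[t, 1])); first by rewrite openC; exact: closed_im.
    apply/seteqP; split=> p [Ip].
      move=> [s + sp]; rewrite /= in_itv/= => /andP[s0 st]; split=> // -[s'].
      rewrite /= in_itv/= => /andP[ts' s'1] s'p.
      have ss' : s = s' by apply: inj; rewrite ?s0 ?s'1 ?(le_trans st) ?(le_trans t0)// s'p.
      apply: nIq; rewrite -ftq; suff -> : t = s by rewrite sp.
      by apply/eqP; rewrite eq_le st andbT ss'.
    move=> nt; split=> //; have [s /andP[s0 s1] sp] := memI p Ip.
    exists s => //=; rewrite in_itv/= s0 leNgt; apply/negP => ts; apply: nt.
    by exists s => //=; rewrite in_itv/= (ltW ts).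
  - by exists (f @` `[0, t]) => //; exact: closed_im.
move=> E; have : (I `&` f @` `[0, t]) y by rewrite E.
move=> [_ [s]]; rewrite /= in_itv/= -f1 => /andP[s0 st] fs.
have s1 : s = 1 by apply: inj; rewrite ?s0 ?(le_trans st)// ?lexx ?ler01.
apply: nIq; rewrite -ftq; suff -> : t = 1 by rewrite f1.
by apply/eqP; rewrite eq_le t1 -s1.
Qed.

Lemma geodesic_four_point_rtree :
  (forall x y, exists g, [/\ g 0 = x, g (mdist x y) = y &
    geodesic_path g (mdist x y)]) -> rtree [set: T].
Proof.
move=> geoT x y _ _ xy; have [g [g0 g1 geo]] := geoT x y.
have d0 : 0 < mdist x y by rewrite mdist_gt0; exact/eqP.
have gE s : 0 <= s <= mdist x y -> mdist x (g s) = s.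
  by move=> /andP[s0 sd]; have := geo 0 s (lexx _) s0 sd; rewrite g0 subr0.
have arc : is_arc x y (g @` `[0, mdist x y]).
  have := short_path_arc d0 (geodesic_short geo) (fun s t hs ht => geodesic_inj geo hs ht).
  by rewrite g0 g1.
exists (g @` `[0, mdist x y]); split=> //.
- move=> J _ arcJ; suff sub : g @` `[0, mdist x y] `<=` J.
    by apply/seteqP; split=> //; exact: (arc_sub arc arcJ).
  move=> _ [s + <-]; rewrite /= in_itv/= => /andP[s0 sd].
  apply: (between_sub_arc arcJ).
  have := geo s _ s0 sd (lexx _); rewrite g1 => ->.
  by rewrite gE ?s0// addrC subrK.
- exists (mdist x); split.
    move=> _ _ [s + <-] [t + <-]; rewrite /= !in_itv/= => hs ht.
    rewrite {1}/mdist/= !gE//; wlog st : s t hs ht / s <= t.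
      move=> H; have [/H->//|/ltW/H h] := leP s t.
      by rewrite distrC metric_sym h.
    have /andP[s0 _] := hs; have /andP[_ t1] := ht.
    by rewrite ger0_norm ?subr_ge0// geo.
  apply/seteqP; split=> [_ [_ [s + <-] <-]|s].
    by rewrite /= in_itv/= => hs; rewrite gE// in_itv.
  rewrite /= in_itv/= => hs; exists (g s); last exact: gE.
  by exists s => //=; rewrite in_itv.
Qed.

End geodesic_four_point.

Section tree_hull.
Context {R : realType} {M : metricType R} (x0 : M).
Hypothesis fpM : four_point M.
Implicit Types p q r : M * R.

(** [(x, t)] stands for the point at height [t] above [x0] on the segment from
    [x0] to [x]; [t] is first clamped to the range of the heights there. *)
Definition height p : R := Num.max 0 (Num.min p.2 (mdist p.1 x0)).

(** The height at which the segments from [x0] to the two points separate. *)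
Definition meet_height p q : R :=
  Num.min (height p) (Num.min (height q) (gromov x0 p.1 q.1)).

Lemma height_ge0 p : 0 <= height p.
Proof. by rewrite /height le_max lexx. Qed.

Lemma height_le p : height p <= mdist p.1 x0.
Proof. by rewrite /height ge_max mdist_ge0 ge_min lexx orbT. Qed.

Lemma heightE x t : 0 <= t <= mdist x x0 -> height (x, t) = t.
Proof. by move=> /andP[t0 tx]; rewrite /height/= min_l// max_r. Qed.

Lemma meet_heightC p q : meet_height p q = meet_height q p.
Proof. by rewrite /meet_height gromovC minCA. Qed.

Lemma meet_height_lel p q : meet_height p q <= height p.
Proof. by rewrite /meet_height ge_min lexx. Qed.

Lemma meet_heightxx p : meet_height p p = height p.
Proof. by rewrite /meet_height gromovxx (min_l (height_le p)) minxx. Qed.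

Lemma meet_height_ultra p q r :
  Num.min (meet_height p q) (meet_height q r) <= meet_height p r.
Proof.
have U := gromov_ultra fpM x0 p.1 q.1 r.1.
have le_gromov p' q' : meet_height p' q' <= gromov x0 p'.1 q'.1.
  by rewrite /meet_height !ge_min lexx !orbT.
rewrite [leRHS]/meet_height !le_min; apply/and3P; split.
- by rewrite ge_min meet_height_lel.
- by rewrite ge_min (meet_heightC q r) meet_height_lel orbT.
- by apply: le_trans U; rewrite le_min; apply/andP; split; rewrite ge_min le_gromov ?orbT.
Qed.

Definition hull_dist p q : R := height p + height q - 2 * meet_height p q.

Lemma hull_distxx p : hull_dist p p = 0.
Proof. by rewrite /hull_dist meet_heightxx; lra. Qed.

Lemma hull_distC p q : hull_dist p q = hull_dist q p.
Proof. by rewrite /hull_dist meet_heightC [height p + _]addrC. Qed.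

Lemma hull_dist_triangle q p r : hull_dist p r <= hull_dist p q + hull_dist q r.
Proof.
have := meet_height_ultra p q r; rewrite /hull_dist.
have := meet_height_lel q p; have := meet_height_lel q r.
rewrite (meet_heightC q p) minEle; case: ifP; lra.
Qed.

Definition hull_pdist := Pseudodist hull_distxx hull_distC hull_dist_triangle.

Definition tree_hull : metricType R := mquot hull_pdist.

Definition hull_pt (x : M) (t : R) : tree_hull := mclass hull_pdist (x, t).

Lemma mdist_hull_pt x y s t :
  mdist (hull_pt x s) (hull_pt y t) = hull_dist (x, s) (y, t).
Proof. exact: mdist_mclass. Qed.

Lemma hull_embedding_isometry x y :
  mdist (hull_pt x (mdist x x0)) (hull_pt y (mdist y x0)) = mdist x y.
Proof.
rewrite mdist_hull_pt /hull_dist /meet_height/= !heightE ?mdist_ge0 ?lexx//.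
rewrite (min_r (gromov_ler x0 x y)) (min_r (gromov_lel x0 x y)) /gromov; lra.
Qed.

Lemma tree_hull_four_point : four_point tree_hull.
Proof.
move=> a b c d.
have [p ->] := mclass_surj a; have [q ->] := mclass_surj b.
have [r ->] := mclass_surj c; have [s ->] := mclass_surj d.
rewrite !mdist_mclass /= /hull_dist.
have := ultrametric_four_point meet_heightC meet_height_ultra p q r s.
rewrite minEle maxEle; case: ifP; case: ifP; lra.
Qed.

Lemma mdist_hull_branch z u v : 0 <= u -> u <= v -> v <= mdist z x0 ->
  mdist (hull_pt z u) (hull_pt z v) = v - u.
Proof.
move=> u0 uv vz; rewrite mdist_hull_pt /hull_dist /meet_height gromovxx/=.
rewrite !heightE ?u0 ?(le_trans uv)// ?(le_trans u0)//.
by rewrite (min_l vz) (min_l uv); lra.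
Qed.

Lemma mclass_height z u : mclass hull_pdist (z, u) = hull_pt z (height (z, u)).
Proof.
apply: mdist_positivity; rewrite mdist_mclass/= /hull_dist.
have E : height (z, height (z, u)) = height (z, u).
  by rewrite heightE// height_ge0 height_le.
have h := height_le (z, u); rewrite /meet_height gromovxx E (min_l h) minxx; lra.
Qed.

(** Down from [(x, s)] to the height of the meet, then up to [(y, t)]. *)
Lemma tree_hull_geodesic (a b : tree_hull) : exists g : R -> tree_hull,
  [/\ g 0 = a, g (mdist a b) = b & geodesic_path g (mdist a b)].
Proof.
have [[x s0] ->] := mclass_surj a; have [[y t0] ->] := mclass_surj b.
rewrite !mclass_height.
have s_ge0 := height_ge0 (x, s0); have s_le := height_le (x, s0).
have t_ge0 := height_ge0 (y, t0); have t_le := height_le (y, t0).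
move: (height (x, s0)) (height (y, t0)) s_ge0 s_le t_ge0 t_le => s t /=.
move=> {s0 t0 a b} s_ge0 s_le t_ge0 t_le.
set c := Num.min s (Num.min t (gromov x0 x y)).
have c0 : 0 <= c by rewrite !le_min s_ge0 t_ge0 gromov_ge0.
have cs : c <= s by rewrite /c ge_min lexx.
have ct : c <= t by rewrite /c !ge_min lexx orbT.
have cg : c <= gromov x0 x y by rewrite /c !ge_min lexx !orbT.
have dE : mdist (hull_pt x s) (hull_pt y t) = (s - c) + (t - c).
  rewrite mdist_hull_pt /hull_dist /meet_height !heightE ?s_ge0 ?t_ge0//= -/c; lra.
have join : hull_pt x c = hull_pt y c.
  apply: mdist_positivity; rewrite mdist_hull_pt /hull_dist /meet_height.
  rewrite (heightE (x := x)) ?c0 ?(le_trans cs)// heightE ?c0 ?(le_trans ct)//=.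
  by rewrite (min_l cg) minxx; lra.
pose g := concat (s - c) (fun u : R => hull_pt x (s - u)) (fun u : R => hull_pt y (c + u)).
have g12 : hull_pt x (s - (s - c)) = hull_pt y (c + 0) by rewrite subKr addr0.
have ga : g 0 = hull_pt x s by rewrite /g concatl ?subr_ge0// subr0.
have gb : g (s - c + (t - c)) = hull_pt y t.
  rewrite /g concatr ?lerDl ?subr_ge0//.
  by have -> : c + (s - c + (t - c) - (s - c)) = t by lra.
exists g; rewrite dE; split=> //.
have D0 : 0 <= s - c + (t - c) by lra.
apply: short_geodesic => //; last by rewrite ga gb dE.
apply: short_concat; rewrite ?subr_ge0// => u v u0 uv vc.
  by rewrite metric_sym mdist_hull_branch; lra.
by rewrite mdist_hull_branch; lra.
Qed.

Lemma tree_hull_rtree : rtree [set: tree_hull].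
Proof. exact: geodesic_four_point_rtree tree_hull_four_point tree_hull_geodesic. Qed.

End tree_hull.

(** * Molecules, and the four-point condition from embeddings into l1 *)

Section ell1_theory.
Context {R : realType}.
Implicit Types u v w : ell1 R.

Definition head N v : R := \sum_(j < N) `|v j|.

Lemma abs_seriesE v n : abs_series v n = head n v.
Proof. by rewrite /abs_series /series/= big_mkord. Qed.

Lemma head_le_norm N v : head N v <= `|v|.
Proof. by rewrite -abs_seriesE; apply: abs_series_lim; exact: ell1P. Qed.

Lemma ell1norm_le v C : (forall n, head n v <= C) -> `|v| <= C.
Proof. by move=> vC; apply: (abs_series_le _).2 => n; rewrite abs_seriesE. Qed.

Lemma head_cvg v e : 0 < e -> exists N, `|v| - e < head N v.
Proof.
move=> e0; apply: contrapT => H; suff : `|v| <= `|v| - e by lra.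
by apply: ell1norm_le => n; rewrite leNgt; apply/negP => vn; apply: H; exists n.
Qed.

Lemma head_mono v N n : (N <= n)%N -> head N v <= head n v.
Proof. by move=> Nn; rewrite -!abs_seriesE; exact: abs_series_nd. Qed.

(** Defined as a difference, so that norms split into heads and tails without
    manipulating infinite sums. *)
Definition tail N v : R := `|v| - head N v.

Lemma tail_ge0 N v : 0 <= tail N v.
Proof. by rewrite subr_ge0 head_le_norm. Qed.

Lemma tailZ N a v : tail N (a *: v) = `|a| * tail N v.
Proof.
rewrite /tail normrZ mulrBr; congr (_ - _); rewrite mulr_sumr.
by apply: eq_bigr => j _; rewrite -normrM.
Qed.

Lemma head_tail N n v : (N <= n)%N -> \sum_(N <= j < n) `|v j| <= tail N v.
Proof.
move=> Nn; rewrite /tail lerBrDl; apply: le_trans (head_le_norm n v).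
by rewrite /head -!(big_mkord xpredT (fun j => `|v j|)) -big_cat_nat.
Qed.

Lemma tailD N u v : tail N (u + v) <= tail N u + tail N v.
Proof.
rewrite {1}/tail lerBlDl; apply: ell1norm_le => n.
have [nN|/ltnW Nn] := leqP n N.
  by rewrite (le_trans (head_mono _ nN))// lerDl addr_ge0 ?tail_ge0.
rewrite {1}/head -(big_mkord xpredT (fun j => `|(u + v) j|)) (big_cat_nat (n := N))//=.
rewrite big_mkord lerD2l (le_trans _ (lerD (head_tail _ Nn) (head_tail _ Nn)))//.
by rewrite -big_split/=; apply: ler_sum => j _; exact: ler_normD.
Qed.

Lemma tail_sum N n (v : 'I_n -> ell1 R) :
  tail N (\sum_i v i) <= \sum_i tail N (v i).
Proof.
elim/big_ind2 : _ => // [|a b c d ab cd]; last exact: le_trans (tailD _ _ _) (lerD ab cd).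
by rewrite -(scale0r (0 : ell1 R)) tailZ normr0 mul0r.
Qed.

Lemma hlawka_real (a b c : R) :
  `|a + b| + `|b + c| + `|a + c| <= `|a| + `|b| + `|c| + `|a + b + c|.
Proof.
have [?|?] := ger0P a; have [?|?] := ger0P b; have [?|?] := ger0P c;
have [?|?] := ger0P (a + b); have [?|?] := ger0P (b + c);
have [?|?] := ger0P (a + c); have [?|?] := ger0P (a + b + c); lra.
Qed.

Lemma hlawka_ell1 u v w :
  `|u + v| + `|v + w| + `|u + w| <= `|u| + `|v| + `|w| + `|u + v + w|.
Proof.
apply/ler_addgt0Pr => e e0; have e3 : 0 < e / 3 by rewrite divr_gt0.
have [N1 h1] := head_cvg (u + v) e3; have [N2 h2] := head_cvg (v + w) e3.
have [N3 h3] := head_cvg (u + w) e3; set n := maxn N1 (maxn N2 N3).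
have := head_mono (u + v) (leq_maxl N1 (maxn N2 N3)).
have := head_mono (v + w) (leq_trans (leq_maxl N2 N3) (leq_maxr N1 _)).
have := head_mono (u + w) (leq_trans (leq_maxr N2 N3) (leq_maxr N1 _)).
have : head n (u + v) + head n (v + w) + head n (u + w) <=
    head n u + head n v + head n w + head n (u + v + w).
  by rewrite -!big_split/=; apply: ler_sum => j _; exact: hlawka_real.
have := head_le_norm n u; have := head_le_norm n v; have := head_le_norm n w.
have := head_le_norm n (u + v + w); rewrite -/n; lra.
Qed.

End ell1_theory.

Section molecules.
Context {R : realType} {M : metricType R} (x0 : M).
Implicit Types (x y : M) (u : free_space x0) (f : Lip0 x0).

Lemma delta_closed_span x : delta x0 x \in closed_span (range (delta x0)).
Proof.
apply/asboolP/subset_closure; exists 1%N, (fun=> 1), (fun=> delta x0 x); split.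
  by move=> _; exists x.
by rewrite big_ord1 scale1r.
Qed.

Definition free_pt x : free_space x0 := MkFree (delta_closed_span x).

Definition molecule x y : free_space x0 := free_pt x - free_pt y.

Lemma moleculeE x y f : molecule x y f = f x - f y.
Proof. by []. Qed.

Lemma free_sumE n (c : 'I_n -> R) (v : 'I_n -> free_space x0) f :
  (\sum_i c i *: v i) f = \sum_i c i * v i f.
Proof.
pose P (w : free_space x0) (r : R) := w f = r.
by apply: (big_ind2 P) => // a r b s; rewrite /P => <- <-.
Qed.

Lemma free_norm_le u C : 0 <= C -> (forall f, `|u f| <= C * `|f|) -> `|u| <= C.
Proof. exact: dualnorm_le. Qed.

Lemma free_normP u f : `|u f| <= `|u| * `|f|.
Proof. exact: dualnormP. Qed.

Lemma lip0_diff f x y : `|f x - f y| <= `|f| * mdist x y.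
Proof. exact: lipnormP. Qed.

Lemma molecule_norm_le x y : `|molecule x y| <= mdist x y.
Proof.
apply: free_norm_le => [|f]; first exact: mdist_ge0.
by rewrite moleculeE mulrC; exact: lip0_diff.
Qed.

(** Molecules do not see constants, so they may be tested on functions that do
    not vanish at the base point. *)
Lemma lip0_shift (g : M -> R) (C : R) : 0 <= C -> lipschitz_with C g ->
  exists2 f : Lip0 x0, `|f| <= C & forall x y, f x - f y = g x - g y.
Proof.
move=> C0 gC; have gP : (fun x => g x - g x0) \in lip0 x0.
  apply/asboolP; split; first by rewrite subrr.
  by exists C => x y; rewrite opprB addrA subrK; exact: gC.
exists (MkLip0 gP) => [|x y] /=; last by rewrite opprB addrA subrK.
by apply: lipnorm_le => // x y /=; rewrite opprB addrA subrK; exact: gC.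
Qed.

(** The functional [f x + f y - f u - f v] is tested on the minimum of two
    distance functions; the shift [s] balances the two. *)
Lemma two_molecules_norm_ge (x y u v : M) :
  Num.min (mdist x u + mdist y v) (mdist x v + mdist y u) <=
  `|molecule x u + molecule y v|.
Proof.
set m := Num.min _ _.
have m1 : m <= mdist x u + mdist y v by rewrite ge_min lexx.
have m2 : m <= mdist x v + mdist y u by rewrite ge_min lexx orbT.
pose s := Num.max (- mdist u v) (m - mdist x v - mdist y v).
have t1 := metric_triangle x u v; have t2 := metric_triangle y u v.
have t3 := metric_triangle x v u; have t4 := metric_triangle y v u.
have uv0 := mdist_ge0 u v; rewrite (metric_sym v u) in t3 t4.
have s1 : - mdist u v <= s by rewrite le_max lexx.
have s2 : m - mdist x v - mdist y v <= s by rewrite le_max lexx orbT.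
have s3 : s <= mdist u v by rewrite ge_max; apply/andP; split; lra.
have s4 : s <= mdist x u + mdist y u - m by rewrite ge_max; apply/andP; split; lra.
move: s1 s2 s3 s4; move: (s) => {}s s1 s2 s3 s4.
pose g z := Num.min (mdist z u) (mdist z v + s).
have g1 : lipschitz_with 1 g.
  move=> z w; rewrite mul1r /g.
  have h1 := metric_triangle z w u; have h2 := metric_triangle w z u.
  have h3 := metric_triangle z w v; have h4 := metric_triangle w z v.
  rewrite (metric_sym w z) in h2 h4; rewrite ler_norml !minEle.
  by case: ifP => ?; case: ifP => ?; apply/andP; split; lra.
have [f f1 fE] := lip0_shift ler01 g1.
have gu : g u = 0 by rewrite /g mdistxx min_l//; lra.
have gv : g v = s by rewrite /g mdistxx add0r (metric_sym v u) min_r.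
have : m <= g x + g y - s.
  by rewrite /g !minEle; case: ifP => ?; case: ifP => ?; lra.
move=> h; apply: le_trans h _; apply: le_trans (_ : `|(molecule x u + molecule y v) f| <= _).
  rewrite [X in `|X|](_ : _ = (f x - f u) + (f y - f v)); last by [].
  by rewrite !fE gu gv subr0 addrA; exact: ler_norm.
by apply: le_trans (free_normP _ _) _; rewrite ler_piMr.
Qed.

(** Hlawka's inequality for the molecules along the path x, u, y, v. *)
Lemma ell1_embedding_four_point :
  (forall e : R, 0 < e -> iso_to_subspace e (free_space x0) (ell1 R)) ->
  four_point M.
Proof.
move=> emb x y u v; set B := mdist x u + _; set C := mdist x v + _.
suff h : mdist x y + mdist u v + Num.min B C <= B + C.
  by move: h; rewrite minEle maxEle; case: ifP; lra.
have BC0 : 0 <= B + C by rewrite !addr_ge0 ?mdist_ge0.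
apply/ler_addgt0Pr => e e0; have [S SP] := emb (e / (B + C + 1)) ltac:(by rewrite divr_gt0 ?ltr_wpDl).
have H := hlawka_ell1 (S (molecule x u)) (S (molecule u y)) (S (molecule y v)).
rewrite -!linearD/= in H.
have E1 : molecule x u + molecule u y = molecule x y by rewrite /molecule addrA subrK.
have E2 : molecule u y + molecule y v = molecule u v by rewrite /molecule addrA subrK.
have E3 : molecule x y + molecule y v = molecule x v by rewrite /molecule addrA subrK.
rewrite E1 E2 E3 in H.
have molecule_norm_ge a b : mdist a b <= `|molecule a b|.
  have := two_molecules_norm_ge a a b b; rewrite minxx.
  have := ler_normD (molecule a b) (molecule a b); lra.
have lo w : `|w| <= `|S w| by have /andP[] := SP w.
have hi w : `|S w| <= (1 + e / (B + C + 1)) * `|w| by have /andP[] := SP w.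
have hi' a b : `|S (molecule a b)| <= (1 + e / (B + C + 1)) * mdist a b.
  apply: le_trans (hi _) _; rewrite ler_wpM2l ?molecule_norm_le//.
  by rewrite addr_ge0// divr_ge0 ?(ltW e0)// addr_ge0.
have := le_trans (two_molecules_norm_ge x y u v) (lo _).
have := le_trans (molecule_norm_ge x y) (lo _).
have := le_trans (molecule_norm_ge u v) (lo _).
have := hi' x u; have := hi' u y; have := hi' y v; have := hi' x v.
have : e / (B + C + 1) * (B + C) <= e.
  by rewrite mulrAC ler_pdivrMr ?ltr_wpDl// ler_wpM2l ?(ltW e0)// lerDl.
move: H; rewrite /B /C (metric_sym u y); nra.
Qed.

End molecules.

(** * Embeddings into l1 force null traces on segments *)

Section signs_and_clamps.
Context {R : realType}.

(** Each sign makes the cross term with the preceding sum nonpositive. *)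
Lemma sign_choice N n (v : nat -> nat -> R) : exists2 c : nat -> R,
  forall i, c i = 1 \/ c i = -1 &
  \sum_(j < N) (\sum_(i < n) c i * v i j) ^+ 2 <=
  \sum_(i < n) \sum_(j < N) v i j ^+ 2.
Proof.
elim: n => [|n [c c1 IH]].
  exists (fun=> 1) => [i|]; first by left.
  by rewrite big_ord0 big1// => j _; rewrite big_ord0 expr0n.
pose X j := \sum_(i < n) c i * v i j.
have [e e1 cross] : exists2 e : R, e = 1 \/ e = -1 & e * \sum_(j < N) X j * v n j <= 0.
  have [h|/ltW h] := leP (\sum_(j < N) X j * v n j) 0.
    by exists 1; [left|rewrite mul1r].
  by exists (-1); [right|rewrite mulN1r oppr_le0].
exists (fun i => if i == n then e else c i) => [i|]; first by case: ifP.
have e2 : e ^+ 2 = 1 by case: e1 => ->; rewrite ?expr1n// sqrrN expr1n.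
have -> : \sum_(j < N) (\sum_(i < n.+1) (if i == n :> nat then e else c i) * v i j) ^+ 2 =
    \sum_(j < N) X j ^+ 2 + \sum_(j < N) v n j ^+ 2 + 2 * (e * \sum_(j < N) X j * v n j).
  rewrite !mulr_sumr -!big_split/=; apply: eq_bigr => j _.
  rewrite big_ord_recr/= eqxx (_ : \sum_(i < n) _ = X j); last first.
    by apply: eq_bigr => i _; rewrite ltn_eqF.
  transitivity (X j ^+ 2 + e ^+ 2 * v n j ^+ 2 + 2 * (e * (X j * v n j))); first ring.
  by rewrite e2 mul1r.
by rewrite big_ord_recr/=; move: IH; rewrite -/(X _) => IH; lra.
Qed.

Definition clamp (a b t : R) : R := Num.max a (Num.min t b).

Lemma clamp_sum_le (a b : nat -> R) n s t :
  (forall k, (k < n)%N -> b k <= a k <= b k.+1) -> s <= t ->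
  \sum_(k < n) `|clamp (a k) (b k.+1) t - clamp (a k) (b k.+1) s| <=
  Num.min t (b n) - Num.min s (b n).
Proof.
move=> + st; elim: n => [_|n IH ab].
  by rewrite big_ord0 subr_ge0 le_min !ge_min st lexx orbT.
rewrite big_ord_recr/=; have := IH (fun k kn => ab k (leqW kn)).
have /andP[ba ab'] := ab n (leqnn _); set Z : R := \sum_(_ < _) _.
have mono : clamp (a n) (b n.+1) s <= clamp (a n) (b n.+1) t.
  by rewrite /clamp ge_max !le_max lexx/= le_min !ge_min st lexx !orbT.
rewrite ger0_norm ?subr_ge0//; move: Z => Z.
rewrite /clamp {mono IH}; move: st ba ab'; move: (a n) (b n) (b n.+1) => x y z.
case: (leP s y) => ?; case: (leP t y) => ?; case: (leP s z) => ?; case: (leP t z) => ?;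
case: (leP x s) => ?; case: (leP x t) => ?; case: (leP x z) => ?; lra.
Qed.

End signs_and_clamps.

Section null_image.
Context {R : realType} {M : metricType R} (x0 : M).
Variables (A : set M) (phi : M -> R).
Hypothesis phi_lip : lipschitz_with 1 phi.
Hypothesis phi_iso : forall x y, A x -> A y -> `|phi x - phi y| = mdist x y.

Let K : set R := phi @` A.

Lemma mdist_phi x y : A x -> A y -> phi x <= phi y -> mdist x y = phi y - phi x.
Proof. by move=> Ax Ay xy; rewrite -phi_iso// distrC ger0_norm ?subr_ge0. Qed.

(** An almost smallest and an almost largest point of [K] in the cell; if the cell
    contains no point of [K], a step of length 0 at the previous point. *)
Lemma cell_points (a b tau : R) (q : M) : A q -> phi q <= a -> a <= b -> 0 < tau ->
  exists pq : M * M, [/\ A pq.1 /\ A pq.2, phi q <= phi pq.1 <= phi pq.2,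
    phi pq.2 <= b, phi pq.2 - phi pq.1 <= b - a &
    (outer_length (K `&` `]a, b]) <= (phi pq.2 - phi pq.1 + tau)%:E)%E].
Proof.
move=> Aq qa ab tau0; pose Z := K `&` `]a, b]%classic.
have [Z0|/set0P[z0 Zz0]] := eqVneq Z set0.
  exists (q, q); split=> //=; rewrite ?lexx ?(le_trans qa)// subrr ?subr_ge0// add0r.
  by rewrite -/Z Z0 -(@set_itvoc0 _ R 0) outer_length_itvoc// subrr lee_fin ltW.
have Zab z : Z z -> a < z <= b by move=> [_]; rewrite /= in_itv.
have supZ : has_sup Z by split; [exists z0|exists b => z /Zab/andP[]].
have infZ : has_inf Z by split; [exists z0|exists a => z /Zab/andP[/ltW]].
have tau2 : 0 < tau / 2 by rewrite divr_gt0.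
have [u Zu uinf] := @inf_adherent R Z _ tau2 infZ.
have [v Zv vsup] := @sup_adherent R Z _ tau2 supZ.
have [/andP[au ub] /andP[av vb]] := (Zab _ Zu, Zab _ Zv).
have [[p Ap pu] [r Ar rv]] := (Zu.1, Zv.1).
have mZ : (outer_length Z <= (sup Z - inf Z)%:E)%E.
  have iZ z : Z z -> inf Z <= z by apply: ge_inf; exact: infZ.2.
  have sZ z : Z z -> z <= sup Z by apply: ub_le_sup; exact: supZ.2.
  apply: le_trans (_ : (outer_length ([set inf Z] `|` `]inf Z, sup Z]) <= _)%E).
    apply: le_outer_length => z Zz /=; rewrite in_itv/= sZ// andbT.
    by have := iZ z Zz; rewrite le_eqVlt => /orP[/eqP|]; [left|right].
  apply: le_trans (outer_lengthU _ _) _.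
  rewrite outer_length_set1 add0e outer_length_itvoc//.
  by rewrite (le_trans (iZ z0 _))// sZ.
exists (p, if u <= v then r else p); rewrite /= pu.
split; case: ifP => uv; rewrite ?rv ?pu ?lexx ?(le_trans qa (ltW au))//=.
- lra.
- by rewrite subrr subr_ge0.
- by apply: le_trans mZ _; rewrite lee_fin; lra.
- by apply: le_trans mZ _; rewrite lee_fin; move/negbT: uv; rewrite -ltNge; lra.
Qed.

Definition cell (a rho : R) (i : nat) : set R :=
  `]a + i%:R * rho, a + i.+1%:R * rho]%classic.

(** One cell after the other, starting at [xa]: the points in the order of
    their images are q_0, p_0, q_1, p_1, ... *)
Lemma cell_chain (a rho tau : R) (xa : M) : A xa -> phi xa = a -> 0 < rho -> 0 < tau ->
  exists p q : nat -> M, q 0 = xa /\ forall i,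
    [/\ A (p i) /\ A (q i), phi (q i) <= phi (p i) <= phi (q i.+1),
      phi (q i) <= a + i%:R * rho,
      phi (q i.+1) - phi (p i) <= rho &
      (outer_length (K `&` cell a rho i) <=
        (phi (q i.+1) - phi (p i) + tau)%:E)%E].
Proof.
move=> Axa xaE rho0 tau0; pose t i : R := a + i%:R * rho.
have tS i : t i.+1 - t i = rho by rewrite /t -addn1 natrD; lra.
have /choice[F FP] : forall iq : nat * M, exists pq : M * M,
    A iq.2 -> phi iq.2 <= t iq.1 ->
    [/\ A pq.1 /\ A pq.2, phi iq.2 <= phi pq.1 <= phi pq.2, phi pq.2 <= t iq.1.+1,
      phi pq.2 - phi pq.1 <= rho &
      (outer_length (K `&` `]t iq.1, t iq.1.+1]) <= (phi pq.2 - phi pq.1 + tau)%:E)%E].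
  move=> [i q] /=; have [[Aq qi]|nq] := pselect (A q /\ phi q <= t i); last first.
    by exists (q, q) => Aq qi; case: nq.
  have [pq pqP] := @cell_points (t i) (t i.+1) tau q Aq qi ltac:(have := tS i; lra) tau0.
  by exists pq => _ _; rewrite -(tS i).
pose q := fix q i := if i is j.+1 then (F (j, q j)).2 else xa.
have qP i : A (q i) /\ phi (q i) <= t i.
  elim: i => [|i [Aq qi]]; first by rewrite /t/= xaE mul0r addr0.
  by have [[]] := FP (i, q i) Aq qi.
exists (fun i => (F (i, q i)).1), q; split=> // i; have [Aq qi] := qP i.
by have [[? ?] ? ? ? ?] := FP (i, q i) Aq qi; split.
Qed.

(** A chain of short steps in [A] carries a signed combination of molecules
    whose norm is the total length of the steps: test it on the function that
    moves with slope the sign along each step. *)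
Lemma signed_molecules_norm_ge (p q : nat -> M) (c : nat -> R) n :
  (forall i, c i = 1 \/ c i = -1) ->
  (forall i, phi (q i) <= phi (p i) <= phi (q i.+1)) ->
  \sum_(i < n) (phi (q i.+1) - phi (p i)) <=
  `|\sum_(i < n) c i *: molecule x0 (q i.+1) (p i)|.
Proof.
move=> c1 qp; pose a i := phi (p i); pose b i := phi (q i).
have cc i : c i * c i = 1 by case: (c1 i) => ->; rewrite ?mulr1// mulrNN mulr1.
have cn i : `|c i| = 1 by case: (c1 i) => ->; rewrite ?normrN normr1.
have bmono i j : (i <= j)%N -> b i <= b j.
  move=> ij; rewrite -(subnK ij); elim: (j - i)%N => // k IH.
  by apply: le_trans IH _; have /andP[] := qp (k + i)%N; exact: le_trans.
pose g z := \sum_(k < n) c k * clamp (a k) (b k.+1) (phi z).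
have g1 : lipschitz_with 1 g.
  move=> z w; rewrite mul1r /g -sumrB.
  apply: le_trans (ler_norm_sum _ _ _) _.
  under eq_bigr do rewrite -mulrBr normrM cn mul1r.
  have := phi_lip z w; rewrite mul1r; apply: le_trans.
  wlog wz : z w / phi w <= phi z.
    move=> H; have [/H//|/ltW/H h] := leP (phi w) (phi z).
    by rewrite distrC; under eq_bigr do rewrite distrC.
  apply: le_trans (clamp_sum_le (n := n) (fun k _ => qp k) wz) _.
  rewrite ger0_norm ?subr_ge0// -/(b n); case: (leP (phi z) (b n)) => ?;
  case: (leP (phi w) (b n)) => ?; lra.
have [f f1 fE] := lip0_shift x0 ler01 g1.
have step i : (i < n)%N -> f (q i.+1) - f (p i) = c i * (b i.+1 - a i).
  move=> ni; rewrite fE /g -sumrB (bigD1 (Ordinal ni))//= big1 => [|k kNi].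
    have /andP[_ ab] := qp i; rewrite /clamp -/(a i) -/(b i.+1).
    by rewrite minxx (min_l ab) (max_r ab) maxxx addr0 mulrBr.
  have /andP[ba ab] := qp i; have /andP[ba' ab'] := qp k.
  rewrite -/(a i) -/(b i.+1) -/(b i) in ba ab *.
  rewrite -/(a k) -/(b k.+1) -/(b k) in ba' ab'.
  apply/eqP; rewrite -mulrBr mulf_eq0 subr_eq0; apply/orP; right.
  have [ki|ik] : (k < i)%N \/ (i < k)%N by apply/orP; rewrite -neq_ltn; exact: kNi.
    have := bmono _ _ ki => ki'; rewrite /clamp !min_r//; lra.
  have := bmono _ _ ik => ik'; rewrite /clamp !min_l ?max_l//; lra.
have := free_normP (\sum_(i < n) c i *: molecule x0 (q i.+1) (p i)) f.
rewrite free_sumE; under eq_bigr => i _.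
  rewrite moleculeE step// mulrA cc mul1r; over.
rewrite ger0_norm; last first.
  by apply: sumr_ge0 => i _; rewrite subr_ge0; have /andP[] := qp i.
by move=> h; apply: le_trans h _; rewrite ler_piMr.
Qed.

Variable S : {linear free_space x0 -> ell1 R}.
Variable e : R.
Hypothesis SP : forall u, `|u| <= `|S u| <= (1 + e) * `|u|.
Hypothesis e01 : 0 <= e <= 1.

Lemma norm_S_molecule x y : A x -> A y -> phi x <= phi y ->
  `|S (molecule x0 y x)| <= (1 + e) * (phi y - phi x).
Proof.
move=> Ax Ay xy; have /andP[_ h] := SP (molecule x0 y x); apply: le_trans h _.
have /andP[e0 _] := e01; rewrite ler_wpM2l ?addr_ge0// -mdist_phi// metric_sym.
exact: molecule_norm_le.
Qed.

(** The heads of the images of the steps of a chain add up to at least the head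
    of the image of the whole, which leaves little for the tails. *)
Lemma chain_tail_le (p q : nat -> M) N n :
  (forall i, A (p i) /\ A (q i)) ->
  (forall i, phi (q i) <= phi (p i) <= phi (q i.+1)) ->
  \sum_(i < n) tail N (S (molecule x0 (q i.+1) (p i))) <=
  (1 + e) * (phi (q n) - phi (q 0)) - head N (S (molecule x0 (q n) (q 0))).
Proof.
have headD u v : head N (u + v : ell1 R) <= head N u + head N v.
  by rewrite -big_split; apply: ler_sum => j _; exact: ler_normD.
move=> Apq qp; elim: n => [|n IH].
  rewrite big_ord0 /molecule !subrr mulr0 raddf0 sub0r oppr_ge0.
  by rewrite /head big1// => j _; rewrite normr0.
rewrite big_ord_recr/=; have [[Ap Aq] [_ Aq']] := (Apq n, Apq n.+1).
have /andP[le1 le2] := qp n.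
have h1 := norm_S_molecule Ap Aq' le2; have h2 := norm_S_molecule Aq Ap le1.
have h3 := head_le_norm N (S (molecule x0 (p n) (q n))).
have h4 := headD (S (molecule x0 (q n.+1) (p n)) + S (molecule x0 (p n) (q n)))
  (S (molecule x0 (q n) (q 0))).
have h5 := headD (S (molecule x0 (q n.+1) (p n))) (S (molecule x0 (p n) (q n))).
have E : S (molecule x0 (q n.+1) (p n)) + S (molecule x0 (p n) (q n)) +
    S (molecule x0 (q n) (q 0)) = S (molecule x0 (q n.+1) (q 0)).
  by rewrite -!linearD /molecule !addrA !subrK.
rewrite E in h4; rewrite /tail; lra.
Qed.

End null_image.

Section ell1_signs.
Context {R : realType}.

Lemma ell1_sumE n (c : 'I_n -> R) (w : 'I_n -> ell1 R) j :
  (\sum_i c i *: w i) j = \sum_i c i * w i j.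
Proof.
pose P (v : ell1 R) (r : R) := v j = r.
by apply: (big_ind2 P) => // a r b s; rewrite /P => <- <-.
Qed.

Lemma head_sqr_le N (v : ell1 R) : \sum_(j < N) v j ^+ 2 <= `|v| ^+ 2.
Proof.
have vj j : `|v j| <= `|v|.
  apply: le_trans (head_le_norm j.+1 v).
  by rewrite /head big_ord_recr/= lerDr sumr_ge0.
rewrite expr2; apply: le_trans (_ : `|v| * head N v <= _); last first.
  by rewrite ler_wpM2l// head_le_norm.
rewrite mulr_sumr; apply: ler_sum => j _.
by rewrite -[v j ^+ 2]ger0_norm ?sqr_ge0// normrX expr2 ler_wpM2r.
Qed.

(** [sign_choice] controls the sum of the squares of the coordinates, hence each
    coordinate. *)
Lemma head_signs N n (w : nat -> ell1 R) (B : R) : 0 <= B ->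
  \sum_(i < n) `|w i| ^+ 2 <= B ^+ 2 ->
  exists2 c : nat -> R, forall i, c i = 1 \/ c i = -1 &
    head N (\sum_(i < n) c i *: w i) <= N%:R * B.
Proof.
move=> B0 wB; have [c c1 cX] := sign_choice N n (fun i j => w i j).
exists c => //; have -> : N%:R * B = \sum_(j < N) B.
  by rewrite sumr_const card_ord mulr_natl.
apply: ler_sum => j _; rewrite ell1_sumE.
rewrite -(ler_pXn2r (n := 2))// ?nnegrE// real_normK ?num_real//.
apply: le_trans wB; apply: le_trans (_ : \sum_(i < n) \sum_(j < N) w i j ^+ 2 <= _); last first.
  by apply: ler_sum => i _; exact: head_sqr_le.
apply: le_trans cX; rewrite (bigD1 j)//= lerDl.
by apply: sumr_ge0 => k _; exact: sqr_ge0.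
Qed.

End ell1_signs.

Section ell1_embedding_null.
Context {R : realType} {M : metricType R} (x0 : M).
Hypothesis emb : forall e : R, 0 < e -> iso_to_subspace e (free_space x0) (ell1 R).
Variables (A : set M) (phi : M -> R).
Hypothesis phi_lip : lipschitz_with 1 phi.
Hypothesis phi_iso : forall x y, A x -> A y -> `|phi x - phi y| = mdist x y.

Let K : set R := phi @` A.

(** Cut [phi xa, phi xb] into many equal cells and choose a step of [A] in each.
    With the signs of [head_signs] the combination of the steps has a small head
    and, by [chain_tail_le], a small tail, while its norm is about the measure
    of the part of [K] between the endpoints. *)
Lemma null_piece xa xb (eta : R) : A xa -> A xb -> phi xa < phi xb -> 0 < eta ->
  (outer_length (K `&` `]phi xa, phi xb]) <= eta%:E)%E.
Proof.
move=> Axa Axb ab eta0; set a := phi xa in ab *; set b := phi xb in ab *.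
pose L := b - a; have L0 : 0 < L by rewrite subr_gt0.
pose h := eta / 4; have h0 : 0 < h by rewrite divr_gt0.
pose e := Num.min 1 (h / L); have hL0 : 0 < h / L by rewrite divr_gt0.
have e0 : 0 < e by rewrite lt_min ltr01.
have eL : e * L <= h by rewrite -ler_pdivlMr// ge_min lexx orbT.
have e01 : 0 <= e <= 1 by rewrite ltW//= ge_min lexx.
have [S SP] := emb e0.
have [N hN] := head_cvg (S (molecule x0 xb xa)) h0.
pose B := h / N.+1%:R; have B0 : 0 < B by rewrite divr_gt0.
have NB : N%:R * B <= h.
  by rewrite mulrCA ler_piMr ?(ltW h0)// ler_pdivrMr ?ltr0Sn// mul1r ler_nat.
have [P P0 LP] : exists2 P, (0 < P)%N & 4 * L ^+ 2 / P%:R <= B ^+ 2.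
  exists (Num.bound (4 * L ^+ 2 / B ^+ 2)).+1 => //.
  rewrite ler_pdivrMr// -ler_pdivrMl ?exprn_gt0// mulrC.
  have X0 : 0 <= 4 * L ^+ 2 / B ^+ 2 by apply: divr_ge0; rewrite ?sqr_ge0// pmulr_rge0 ?sqr_ge0.
  by apply/ltW/(lt_trans (archi_boundP X0)); rewrite ltr_nat.
have P0' : 0 < P%:R :> R by rewrite ltr0n.
pose rho := L / P%:R; have rho0 : 0 < rho by rewrite divr_gt0.
have rhoP : P%:R * rho = L by rewrite mulrC divfK// gt_eqF.
pose tau := h / P%:R; have tau0 : 0 < tau by rewrite divr_gt0.
have tauP : P%:R * tau = h by rewrite mulrC divfK// gt_eqF.
have [p [q [q0 pqP]]] := cell_chain Axa (erefl a) rho0 tau0.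
have Apq i : A (p i) /\ A (q i) by have [] := pqP i.
have qp i : phi (q i) <= phi (p i) <= phi (q i.+1) by have [] := pqP i.
have qPb : phi (q P) <= b.
  by have [_ _ + _ _] := pqP P; rewrite rhoP /L addrC subrK.
pose D i := phi (q i.+1) - phi (p i).
have D0 i : 0 <= D i by rewrite subr_ge0; have /andP[] := qp i.
have DL n : \sum_(i < n) D i <= phi (q n) - a.
  elim: n => [|n IH]; first by rewrite big_ord0 q0 subrr.
  by rewrite big_ord_recr/=; have /andP[] := qp n; rewrite /D; lra.
have KD : (outer_length (K `&` `]a, b]) <= (\sum_(i < P) D i + h)%:E)%E.
  rewrite -tauP.
  suff cov n : (outer_length (K `&` `]a, (a + n%:R * rho)%R]) <=
      (\sum_(i < n) D i + n%:R * tau)%:E)%E.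
    by have := cov P; rewrite rhoP /L addrC subrK.
  elim: n => [|n IH].
    rewrite mul0r addr0 big_ord0 add0r mul0r set_itvoc0 setI0.
    by rewrite -(@set_itvoc0 _ R 0) outer_length_itvoc// subrr.
  have [_ _ _ _ cn] := pqP n.
  apply: le_trans (_ : (outer_length (K `&` `]a, (a + n%:R * rho)%R] `|` K `&` cell a rho n) <= _)%E).
    apply: le_outer_length => t [Kt]; rewrite /= in_itv/= => /andP[at_ tn].
    have [tn'|tn'] := leP t (a + n%:R * rho); [left|right]; split=> //.
      by rewrite /= in_itv/= at_.
    by rewrite /cell/= in_itv/= tn'.
  apply: le_trans (outer_lengthU _ _) _; apply: le_trans (leeD IH cn) _.
  by rewrite -EFinD lee_fin big_ord_recr/= -natr1 -/(D n); lra.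
apply: le_trans KD _; rewrite lee_fin.
pose w i := S (molecule x0 (q i.+1) (p i)).
have wD i : `|w i| <= 2 * D i.
  have [[Ap _] [_ Aq]] := (Apq i, Apq i.+1); have /andP[_ le] := qp i.
  apply: le_trans (norm_S_molecule phi_iso SP e01 Ap Aq le) _.
  by rewrite ler_wpM2r ?D0//; have /andP[_] := e01; lra.
have wB : \sum_(i < P) `|w i| ^+ 2 <= B ^+ 2.
  apply: le_trans LP; apply: le_trans (_ : \sum_(i < P) 4 * rho * D i <= _); last first.
    have -> : 4 * L ^+ 2 / P%:R = 4 * rho * L by rewrite /rho; ring.
    rewrite -mulr_sumr ler_wpM2l ?mulr_ge0 ?(ltW rho0) ?(ltW L0)//.
    by apply: le_trans (DL P) _; rewrite /L lerB.
  apply: ler_sum => i _; have [_ _ _ Drho _] := pqP i.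
  apply: le_trans (_ : (2 * D i) ^+ 2 <= _).
    by rewrite lerXn2r ?nnegrE ?mulr_ge0// wD.
  by have := D0 i; rewrite -/(D i) in Drho; nra.
have [c c1 cB] := head_signs N (ltW B0) wB.
have lower : \sum_(i < P) D i <= _ := signed_molecules_norm_ge x0 phi_lip P c1 qp.
set G := \sum_(i < P) c i *: molecule x0 (q i.+1) (p i) in lower.
have SG : S G = \sum_(i < P) c i *: w i.
  by rewrite /G linear_sum; apply: eq_bigr => i _; rewrite linearZ.
have SGtail : tail N (S G) <= \sum_(i < P) tail N (w i).
  rewrite SG; apply: le_trans (tail_sum _ _) _; apply: ler_sum => i _.
  by rewrite tailZ; case: (c1 i) => ->; rewrite ?normrN normr1 mul1r.
have chain := chain_tail_le phi_iso SP e01 N P Apq qp.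
rewrite q0 -/a in chain.
have last : head N (S (molecule x0 xb xa)) <=
    (1 + e) * (b - phi (q P)) + head N (S (molecule x0 (q P) xa)).
  have [_ Aq] := Apq P; have := norm_S_molecule phi_iso SP e01 Aq Axb qPb; rewrite -/b.
  have := head_le_norm N (S (molecule x0 xb (q P))).
  have -> : molecule x0 xb xa = molecule x0 xb (q P) + molecule x0 (q P) xa.
    by rewrite /molecule addrA subrK.
  move=> h1 h2; apply: le_trans (_ : head N (S (molecule x0 xb (q P))) +
    head N (S (molecule x0 (q P) xa)) <= _); last by lra.
  rewrite [S (_ + molecule _ _ _)]linearD -big_split.
  by apply: ler_sum => j _; exact: ler_normD.
have low : L <= `|S (molecule x0 xb xa)|.
  have /andP[h1 _] := SP (molecule x0 xb xa); apply: le_trans h1.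
  have := two_molecules_norm_ge x0 xb xb xa xa; rewrite minxx.
  have := ler_normD (molecule x0 xb xa) (molecule x0 xb xa).
  by rewrite metric_sym (mdist_phi phi_iso Axa Axb (ltW ab)) -/a -/b -/L; lra.
have /andP[GS _] := SP G.
have tG : `|S G| = head N (S G) + tail N (S G) by rewrite /tail addrC subrK.
rewrite -SG in cB; rewrite /w in SGtail; rewrite /h in NB hN eL *; rewrite /L in low eL *.
have {}chain : \sum_(i < P) tail N (S (molecule x0 (q i.+1) (p i))) <=
  (1 + e) * (b - a) - head N (S (molecule x0 xb xa)) by lra.
lra.
Qed.

(** [null_piece] leaves out only the points of [K] beyond [xa] and [xb], which are
    chosen close to the ends of [K]. *)
Lemma ell1_embedding_null : has_lbound K -> has_ubound K ->
  outer_length (phi @` A) = 0%E.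
Proof.
rewrite -/K => lbK ubK; have [->|/set0P K0] := eqVneq K set0.
  by rewrite -(@set_itvoc0 _ R 0) outer_length_itvoc// subrr.
have iK z : K z -> inf K <= z by exact: ge_inf.
have sK z : K z -> z <= sup K by exact: ub_le_sup.
apply/eqP; rewrite eq_le outer_length_ge0 andbT.
apply/lee_addgt0Pr => eta eta0; rewrite add0e.
have e3 : 0 < eta / 3 by rewrite divr_gt0.
have [_ [xa Axa <-] ai] := @inf_adherent R K _ e3 (conj K0 lbK).
have [_ [xb Axb <-] bs] := @sup_adherent R K _ e3 (conj K0 ubK).
have Ka : K (phi xa) by exists xa.
have Kb : K (phi xb) by exists xb.
set a := phi xa in ai Ka; set b := phi xb in bs Kb.
have mid : (outer_length (K `&` `]a, b]) <= (eta / 3)%:E)%E.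
  have [ab|ba] := ltP a b; first exact: null_piece.
  rewrite set_itv_ge ?bnd_simp -?leNgt// setI0.
  by rewrite -(@set_itvoc0 _ R 0) outer_length_itvoc// subrr lee_fin ltW.
apply: le_trans (_ : (outer_length ([set inf K] `|` (`]inf K, a] `|`
    (K `&` `]a, b] `|` `]b, sup K]))) <= _)%E).
  apply: le_outer_length => z Kz.
  have := iK z Kz; rewrite le_eqVlt => /orP[/eqP zi|zi]; [by left|right].
  have [za|az] := leP z a; first by left; rewrite /= in_itv/= zi.
  right; have [zb|bz] := leP z b; [left|right].
    by split=> //=; rewrite in_itv/= az.
  by rewrite /= in_itv/= bz sK.
apply: le_trans (outer_lengthU _ _) _; rewrite outer_length_set1 add0e.
have -> : eta%:E = ((a - inf K + eta / 3 + (sup K - b))%:E +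
   (eta - (a - inf K + eta / 3 + (sup K - b)))%:E)%E by rewrite -EFinD addrC subrK.
apply: le_trans (_ : ((a - inf K)%:E + ((eta / 3)%:E + (sup K - b)%:E) <= _)%E).
  apply: le_trans (outer_lengthU _ _) _; apply: leeD.
    by rewrite outer_length_itvoc// iK.
  apply: le_trans (outer_lengthU _ _) _; apply: leeD => //.
  by rewrite outer_length_itvoc// sK.
by rewrite -!EFinD lee_fin; lra.
Qed.

End ell1_embedding_null.

(** * Cutting the hull of a null set into pieces *)

Section complete_sequences.
Context {R : realType} {M : completeMetricType R}.

(** Completeness by filters, restated for sequences. *)
Lemma cauchy_seq_limit (y : nat -> M) :
  (forall e : R, 0 < e -> exists N, forall i j, (N <= i)%N -> (N <= j)%N ->
    mdist (y i) (y j) < e) ->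
  exists l, forall e : R, 0 < e -> exists N, forall i, (N <= i)%N -> mdist l (y i) < e.
Proof.
move=> H; have cy : cauchy (y @ \oo).
  apply/cauchy_ballP => e e0; have [N HN] := H e e0.
  exists (y @` [set i | (N <= i)%N], y @` [set i | (N <= i)%N]) => /=.
    by split; exists N => // i Ni; exists i.
  by move=> [_ _] /= [[i Ni <-] [j Nj <-]]; rewrite ballEmdist; exact: HN.
have [l yl] : exists l : M, y @ \oo --> l by apply: (cvg_ex (y @ \oo)).1; exact: cauchy_cvg.
exists l => e e0; have /cvg_ballP/(_ e e0)[N _ HN] := yl.
by exists N => i Ni; have := HN i Ni; rewrite ballEmdist.
Qed.

End complete_sequences.

Section tree_pieces.
Context {R : realType} {M : completeMetricType R} (x0 : M).
Hypothesis fpM : four_point M.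
Variable x : nat -> M.
Hypothesis x_dense : forall y (e : R), 0 < e -> exists k, mdist y (x k) < e.
Variable e : R.
Hypothesis e01 : 0 < e < 1.

Local Notation h y := (mdist y x0).
Local Notation m := (gromov x0).

Hypothesis heights_null : forall z, outer_length (heights_on x0 z) = 0%E.

(** The distance from the point at height [t] below [z] to [y]. *)
Let branch_dist z t y : R := h y + t - 2 * Num.min t (m z y).

Lemma gromov_minD z t y y' : Num.min t (m z y) + Num.min t (m z y') <= t + m y y'.
Proof.
have := gromov_ultra fpM x0 y z y'; rewrite (gromovC x0 y z).
case: (leP t (m z y)) => ?; case: (leP t (m z y')) => ?;
by case: (leP (m z y) (m z y')) => ?; lra.
Qed.

Lemma gromov_lip z y y' : m z y - mdist y y' <= m z y'.
Proof.
have := metric_triangle z y y'; have := metric_triangle y y' x0; rewrite /gromov; lra.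
Qed.

(** [M] is complete, so a point of the hull that is not in [M] has positive
    distance to [M]: points of [M] that come closer and closer to it are close to
    each other, and their limit is that point. *)
Lemma branch_dist_pos z t : ~ heights_on x0 z t ->
  exists2 r, 0 < r & forall y, r <= branch_dist z t y.
Proof.
move=> nK; apply: contrapT => H.
have /choice[y yP] : forall n : nat, exists y, branch_dist z t y < n.+1%:R^-1.
  move=> n; apply: contrapT => Hn; apply: H; exists n.+1%:R^-1; first by rewrite invr_gt0.
  by move=> y; rewrite leNgt; apply/negP => yn; apply: Hn; exists y.
have dyy i j : mdist (y i) (y j) <= branch_dist z t (y i) + branch_dist z t (y j).
  have := gromov_minD z t (y i) (y j); rewrite /branch_dist /gromov; lra.
have small (d : R) : 0 < d -> exists N, forall i, (N <= i)%N -> i.+1%:R^-1 < d.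
  move=> d0; have [N _ HN] := near_infty_natSinv_lt (PosNum d0).
  by exists N => i Ni; exact: HN.
have [l lP] : exists l, forall d : R, 0 < d -> exists N, forall i, (N <= i)%N ->
    mdist l (y i) < d.
  apply: cauchy_seq_limit => d d0; have [N HN] := small (d / 2) ltac:(lra).
  exists N => i j Ni Nj; have := dyy i j; have := yP i; have := yP j.
  have := HN i Ni; have := HN j Nj; move: (i.+1%:R^-1) (j.+1%:R^-1) => a b.
  lra.
have l0 : branch_dist z t l <= 0.
  apply/ler_addgt0Pr => d d0; rewrite add0r.
  have [N1 H1] := small (d / 4) ltac:(lra); have [N2 H2] := lP (d / 4) ltac:(lra).
  set i := maxn N1 N2; have := H1 i (leq_maxl _ _); have := H2 i (leq_maxr _ _).
  have := yP i; move: (i.+1%:R^-1) => a; rewrite /branch_dist.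
  have := metric_triangle l (y i) x0; have := gromov_lip z (y i) l.
  rewrite (metric_sym (y i) l).
  by case: (leP t (m z l)) => ?; case: (leP t (m z (y i))) => ?; lra.
apply: nK; exists l; move: l0; rewrite /branch_dist.
by have := gromov_ler x0 z l; case: (leP t (m z l)) => ?; lra.
Qed.

(** The height at which the segment to [x k] leaves the hull of [x0] and the
    preceding points of the sequence. *)
Definition attach k : R := \big[Num.max/0]_(j < k) m (x k) (x j).

Lemma attach_ge0 k : 0 <= attach k.
Proof. by apply: bigmax_ge_id. Qed.

Lemma attach_ge k j : (j < k)%N -> m (x k) (x j) <= attach k.
Proof. by move=> jk; apply: (le_bigmax _ (fun j : 'I_k => m (x k) (x j)) (Ordinal jk)). Qed.

(** The base value 0 of the maximum is the height of [x0] itself. *)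
Lemma attach_lt k t : 0 < t -> (forall j, (j < k)%N -> m (x k) (x j) < t) -> attach k < t.
Proof. by move=> t0 H; apply/bigmax_ltP; split=> // j _; exact: H. Qed.

(** Summable over the segments: a branch may lose a piece on each of them. *)
Definition eps k : R := e / 2 ^+ k.+2.

Lemma eps_gt0 k : 0 < eps k.
Proof. by have /andP[e0 _] := e01; rewrite divr_gt0// exprn_gt0. Qed.

Lemma eps_le k : eps k <= e.
Proof.
have /andP[e0 _] := e01; rewrite ler_pdivrMr ?exprn_gt0// ler_peMr ?(ltW e0)//.
by rewrite exprn_ege1// ler1n.
Qed.

Lemma eps_sum n : \sum_(k < n) 2 * eps k <= e.
Proof.
have /andP[e0 _] := e01; suff -> : \sum_(k < n) 2 * eps k = e - e / 2 ^+ n.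
  by rewrite lerBlDr lerDl divr_ge0 ?exprn_ge0// ltW.
elim: n => [|n IH]; first by rewrite big_ord0 expr0 divr1 subrr.
rewrite big_ord_recr/= IH /eps !exprS !invfM.
move: (2 ^+ n)^-1 => q; lra.
Qed.

(** [(a, b]] is a piece of the segment to [x k] that is short compared with the
    length of the branches that leave it. *)
Definition good_piece k (a b : R) : Prop :=
  [/\ attach k <= a, b <= h (x k) &
   forall y, a < m y (x k) < b -> b - a <= eps k * (h y - m y (x k))].

Lemma good_piece_small k t : attach k < t < h (x k) -> ~ heights_on x0 (x k) t ->
  exists2 r, 0 < r & forall a b, a < t <= b -> b - a < r -> good_piece k a b.
Proof.
move=> /andP[ct th] nK; have [r r0 rP] := branch_dist_pos nK.
have k0 := eps_gt0 k; have k1 : eps k < 1.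
  by have /andP[_] := e01; have := eps_le k; lra.
exists (Num.min (Num.min (t - attach k) (h (x k) - t)) (eps k * r / 2)).
  by rewrite !lt_min !subr_gt0 ct th/= divr_gt0// pmulr_rgt0.
move=> a b /andP[at_ tb]; rewrite !lt_min => /andP[/andP[h1 h2] h3].
split; [lra|lra|move=> y /andP[ay yb]].
have := rP y; rewrite /branch_dist (gromovC x0 (x k)) => ry.
have {}ry : r - (b - a) <= h y - m y (x k).
  by move: ry; case: (leP t (m y (x k))) => ?; lra.
apply: le_trans (_ : eps k * (r - (b - a)) <= _); last by rewrite ler_wpM2l// ltW.
nra.
Qed.

(** A family of good pieces of all segments in one sequence, as the coordinates of
    l1 are; empty pieces fill up the sequence. *)
Record pieces := Pieces {
  p_seg : nat -> nat ; p_inf : nat -> R ; p_sup : nat -> R ;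
  p_le : forall n, p_inf n <= p_sup n ;
  p_good : forall n, p_inf n < p_sup n -> good_piece (p_seg n) (p_inf n) (p_sup n) ;
  p_disjoint : forall n n' t, p_seg n = p_seg n' ->
    p_inf n < t <= p_sup n -> p_inf n' < t <= p_sup n' -> n = n' ;
  p_cover : forall k t, attach k < t < h (x k) -> ~ heights_on x0 (x k) t ->
    exists2 n, p_seg n = k & p_inf n < t <= p_sup n }.

Lemma pieces_exist : exists _ : pieces, True.
Proof.
have /choice[ab abP] := fun k => whitney_decomposition (good_piece k).
have /choice[bb bbP] := abP.
pose kn N : nat * nat := odflt (0%N, 0%N) (unpickle N).
pose act N := pickle (kn N) == N.
pose a N := if act N then ab (kn N).1 (kn N).2 else 0.
pose b N := if act N then bb (kn N).1 (kn N).2 else 0.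
unshelve (eexists; last by []); apply: (@Pieces (fun N => (kn N).1) a b).
- by move=> N; rewrite /a /b; case: ifP => // _; have [] := bbP (kn N).1.
- move=> N; rewrite /a /b; case: ifP => [_|_]; last by rewrite ltxx.
  by have [_ + _ _] := bbP (kn N).1; exact.
- move=> N N' t seg; rewrite /a /b.
  case: ifPn => [/eqP aN|_]; last by move=> /andP[/lt_le_trans H /H]; rewrite ltxx.
  case: ifPn => [/eqP aN'|_]; last by move=> _ /andP[/lt_le_trans H /H]; rewrite ltxx.
  rewrite -seg; have [_ _ dis _] := bbP (kn N).1 => tN tN'.
  have E := dis _ _ t Logic.I Logic.I tN tN'.
  apply: etrans (esym aN) (etrans _ aN'); congr pickle.
  by case: (kn N) (kn N') seg E => [? ?] [? ?]/= -> ->.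
- move=> k t tk nK; have [_ _ _ /(_ t (good_piece_small tk nK))[n tn]] := bbP k.
  exists (pickle (k, n)); first by rewrite /kn pickleK.
  have E : kn (pickle (k, n)) = (k, n) by rewrite /kn pickleK.
  by rewrite /a /b /act E eqxx.
Qed.

Variable P : pieces.
Local Notation seg := (p_seg P).
Local Notation inf_ := (p_inf P).
Local Notation sup_ := (p_sup P).

Definition weight N : R := sup_ N - inf_ N.

(** The points whose segment to [x0] runs through the whole piece [N]. *)
Definition beyond N (y : M) : bool :=
  (inf_ N < sup_ N) && (sup_ N <= m y (x (seg N))).

Lemma weight_ge0 N : 0 <= weight N.
Proof. by rewrite subr_ge0 p_le. Qed.

Lemma beyond_good N y : beyond N y ->
  good_piece (seg N) (inf_ N) (sup_ N).
Proof. by move=> /andP[/p_good]. Qed.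

Lemma beyond_base N : beyond N x0 = false.
Proof.
apply/negP => Nx; have [c _ _] := beyond_good Nx; move: Nx => /andP[lt le].
have := gromov_lel x0 x0 (x (seg N)); rewrite mdistxx.
have := attach_ge0 (seg N); lra.
Qed.

(** The branch to [y] takes its heights from the segments to the [x k] one after
    the other. *)
Lemma attach_unique y k j t : attach k < t <= m y (x k) ->
  attach j < t <= m y (x j) -> k = j.
Proof.
wlog kj : k j / (k <= j)%N.
  by move=> H; have [/H//|/ltnW/H h2 h3 h4] := leqP k j; rewrite h2.
move=> /andP[_ tk] /andP[tj tj']; move: kj; rewrite leq_eqVlt => /orP[/eqP//|kj].
exfalso.
move: (attach_ge kj) (gromov_ultra fpM x0 (x j) y (x k)) => {kj}.
rewrite (gromovC x0 (x j) y); case: (leP (m y (x j)) (m y (x k))) => ?; lra.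
Qed.

Lemma beyond_disjoint y N N' t : beyond N y -> beyond N' y ->
  inf_ N < t <= sup_ N -> inf_ N' < t <= sup_ N' -> N = N'.
Proof.
move=> Ny Ny' tN tN'.
have [c _ _] := beyond_good Ny; have [c' _ _] := beyond_good Ny'.
apply: (p_disjoint _ tN tN').
move: Ny Ny' => /andP[_ s] /andP[_ s'].
by apply: (@attach_unique y _ _ t); lra.
Qed.

(** If some branch runs through both pieces, the one at the smaller height lies
    on the way to the other one. *)
Lemma beyond_compatible N N' : compatible_cuts (beyond N) (beyond N').
Proof.
have [[y0 [yN yN']]|H] := pselect (exists y, beyond N y /\ beyond N' y); last first.
  apply: Or31 => y yN; apply/negP => yN'; apply: H; by exists y.
have sub i j : beyond i y0 -> beyond j y0 -> sup_ i <= sup_ j ->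
    forall y, beyond j y -> beyond i y.
  move=> /andP[lti iy0] /andP[_ jy0] ij y /andP[_ jy]; rewrite /beyond lti/=.
  have := gromov_ultra fpM x0 y y0 (x (seg i)).
  have := gromov_ultra fpM x0 y (x (seg j)) y0; rewrite (gromovC x0 (x (seg j))).
  case: (leP (m y (x (seg j))) _) => ?; case: (leP (m y y0) _) => ?; lra.
have [ij|/ltW ji] := leP (sup_ N) (sup_ N').
  by apply: Or33; exact: sub.
by apply: Or32; exact: sub.
Qed.

Definition one_sided n y z : R :=
  \sum_(N < n | beyond N y && ~~ beyond N z) weight N.

Lemma cut_metricE n y z :
  cut_metric n beyond weight y z = one_sided n y z + one_sided n z y.
Proof.
rewrite /cut_metric /one_sided (big_mkcond (fun N : 'I_n => beyond N y && _)).
rewrite (big_mkcond (fun N : 'I_n => beyond N z && _)) -big_split/=.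
apply: eq_bigr => N _.
by case: (beyond N y) (beyond N z) => [] []; rewrite /= ?mulr1 ?mulr0 ?addr0 ?add0r.
Qed.

Lemma one_sided_mono n n' y z : (n <= n')%N -> one_sided n y z <= one_sided n' y z.
Proof.
move=> nn'; rewrite /one_sided.
rewrite -!(big_mkord (fun N => beyond N y && ~~ beyond N z) weight).
rewrite (big_cat_nat (n := n) _ nn')//= lerDl; apply: sumr_ge0 => N _.
exact: weight_ge0.
Qed.

(** The pieces form disjoint intervals of heights between that of the meet of
    [y] and [z] and that of [y], except for one through the meet, which is short
    compared with the branch to [z]. *)
Lemma one_sided_le n y z :
  one_sided n y z <= (h y - m y z) + e * (h z - m y z).
Proof.
have /andP[e0 _] := e01.
have my := gromov_lel x0 y z; have mz := gromov_ler x0 y z.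
have ez : 0 <= e * (h z - m y z) by rewrite mulr_ge0 ?subr_ge0 ?(ltW e0).
have -> : h y - m y z + e * (h z - m y z) = h y - (m y z - e * (h z - m y z)) by lra.
apply: disjoint_intervals_length => [|N /andP[Ny Nz]|i j t]; first lra.
  have [_ _ short] := beyond_good Ny; rewrite p_le/=.
  move: (Ny) (Nz) => /andP[lt sy]; rewrite /beyond lt/= -ltNge => zs.
  split; last by apply: le_trans sy (gromov_lel _ _ _).
  have [|am] := leP (m y z) (inf_ N); first lra.
  have E : m y z = m z (x (seg N)).
    by apply: gromov_lt_eq => //; exact: lt_le_trans zs sy.
  have := short z; rewrite -E am; rewrite -E in zs; rewrite zs => /(_ isT).
  have : eps (seg N) * (h z - m y z) <= e * (h z - m y z).
    by rewrite ler_wpM2r ?eps_le// subr_ge0.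
  lra.
move=> /andP[iy _] /andP[jy _] ti tj; apply: val_inj.
exact: (beyond_disjoint iy jy ti tj).
Qed.

Lemma cut_metric_le n y z : cut_metric n beyond weight y z <= (1 + e) * mdist y z.
Proof.
have h1 := one_sided_le n y z; have h2 := one_sided_le n z y.
rewrite (gromovC x0 z y) in h2; rewrite cut_metricE.
have E : mdist y z = (h y - m y z) + (h z - m y z) by rewrite /gromov; lra.
by rewrite E; lra.
Qed.

(** What is missing are the pieces that the branch to [y] leaves in the middle:
    at most one on each segment, and these are short. *)
Lemma one_sided_ge y z :
  exists n, (1 - 2 * e) * (h y - m y z) <= one_sided n y z.
Proof.
have /andP[e0 _] := e01; set H := h y - m y z.
have [H0|H0] : H = 0 \/ 0 < H.
  have := gromov_lel x0 y z; rewrite -subr_ge0 le_eqVlt -/H => /orP[/eqP<-|]; tauto.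
  by exists 0%N; rewrite H0 mulr0 /one_sided big_ord0.
apply: contrapT => none.
have {}none n : one_sided n y z <= (1 - 2 * e) * H.
  by rewrite leNgt; apply/negP => lt; apply: none; exists n; exact: ltW.
pose sel N := beyond N y && ~~ beyond N z.
pose a N := if sel N then inf_ N else 0; pose b N := if sel N then sup_ N else 0.
pose a' k := m y (x k) - eps k * H; pose b' k := m y (x k) + eps k * H.
pose Z := [set h y] `|` \bigcup_k heights_on x0 (x k).
have Z0 : outer_length Z = 0%E.
  apply/eqP; rewrite eq_le outer_length_ge0 andbT.
  apply: le_trans (outer_lengthU _ _) _.
  by rewrite outer_length_set1 outer_length_bigcup0 ?adde0.
have Lab : (outer_length (\bigcup_N `]a N, b N]%classic) <= ((1 - 2 * e) * H)%:E)%E.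
  apply: outer_length_bigcup_itv => n; first by rewrite /a /b; case: ifP => // _; exact: p_le.
  apply: le_trans (none n); rewrite /one_sided [leRHS]big_mkcond/=.
  apply: ler_sum => N _; rewrite /a /b -/(sel N).
  by case: ifP; rewrite ?subrr.
have Lab' : (outer_length (\bigcup_k `]a' k, b' k]%classic) <= (e * H)%:E)%E.
  have k0 k := eps_gt0 k.
  apply: outer_length_bigcup_itv => n.
    by rewrite /a' /b' lerD2l ge0_cp// mulr_ge0 ?(ltW (k0 _)) ?(ltW H0).
  rewrite (eq_bigr (fun k : 'I_n => 2 * eps k * H)) => [|k _]; last by rewrite /a' /b'; ring.
  by rewrite -mulr_suml ler_wpM2r ?(ltW H0) ?eps_sum.
have cov : `]m y z, h y]%classic `<=`
    Z `|` (\bigcup_N `]a N, b N]%classic `|` \bigcup_k `]a' k, b' k]%classic).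
  move=> t; rewrite /= in_itv/= => /andP[mt th].
  have [->|/eqP tNh] := eqVneq t (h y); first by left; left.
  have {}th : t < h y by rewrite lt_neqAle th andbT; exact/eqP.
  have t0 : 0 < t by apply: le_lt_trans mt; exact: gromov_ge0.
  have exk : exists k, t <= m y (x k).
    have [k yk] := x_dense y (e := h y - t) ltac:(lra); exists k.
    have := metric_triangle y (x k) x0; rewrite /gromov; lra.
  case: (ex_minnP exk) => k tk kmin.
  have ck : attach k < t.
    apply: attach_lt => // j jk; rewrite ltNge; apply/negP => tj.
    have : t <= m y (x j).
      have := gromov_ultra fpM x0 y (x k) (x j).
      by case: (leP (m y (x k)) (m (x k) (x j))) => ?; lra.
    by move=> /kmin; rewrite leqNgt jk.
  have [tK|nK] := pselect (heights_on x0 (x k) t); first by left; right; exists k.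
  have tx : t < h (x k).
    rewrite lt_neqAle (le_trans tk (gromov_ler _ _ _)) andbT; apply/eqP => tx.
    by apply: nK; exists (x k); rewrite gromovxx.
  have [N Nk /andP[Nt tN]] := p_cover P (introT andP (conj ck tx)) nK.
  have NN : inf_ N < sup_ N by lra.
  right; have [le|gt] := leP (sup_ N) (m y (x k)); [left|right].
    exists N => //; rewrite /= in_itv/= /a /b.
    have -> : sel N; last by rewrite Nt.
    rewrite /sel /beyond Nk NN le/= -ltNge.
    rewrite ltNge; apply/negP => zN; have := gromov_ultra fpM x0 y (x k) z.
    rewrite (gromovC x0 (x k) z).
    by case: (leP (m y (x k)) (m z (x k))) => ?; lra.
  exists k => //; rewrite /= in_itv/= /a' /b'.
  have := p_good NN; rewrite Nk => -[_ _ /(_ y)].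
  have -> : inf_ N < m y (x k) < sup_ N by apply/andP; split; lra.
  move=> /(_ isT) h1.
  have : eps k * (h y - m y (x k)) <= eps k * H.
    by rewrite ler_wpM2l ?(ltW (eps_gt0 k))// /H; lra.
  by move=> h2; apply/andP; split; lra.
have : (outer_length `]m y z, h y] <= (((1 - 2 * e) * H) + e * H)%:E)%E.
  apply: le_trans (le_outer_length cov) _; apply: le_trans (outer_lengthU _ _) _.
  rewrite Z0 add0e; apply: le_trans (outer_lengthU _ _) _.
  by rewrite EFinD; apply: leeD.
rewrite outer_length_itvoc ?gromov_lel// lee_fin -/H.
have : 0 < e * H by rewrite mulr_gt0.
lra.
Qed.

Lemma cut_metric_ge y z : exists n0, forall n, (n0 <= n)%N ->
  (1 - 2 * e) * mdist y z <= cut_metric n beyond weight y z.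
Proof.
have [n1 h1] := one_sided_ge y z; have [n2 h2] := one_sided_ge z y.
exists (maxn n1 n2) => n; rewrite geq_max => /andP[/(@one_sided_mono _ _ y z) m1].
move=> /(@one_sided_mono _ _ z y) m2; rewrite cut_metricE.
rewrite (gromovC x0 z y) in h2.
have -> : mdist y z = (h y - m y z) + (h z - m y z) by rewrite /gromov; lra.
lra.
Qed.

Lemma cut_metric_ge_fin (I : finType) (pt : I -> M) : exists n, forall i j,
  (1 - 2 * e) * mdist (pt i) (pt j) <= cut_metric n beyond weight (pt i) (pt j).
Proof.
have /choice[N NP] : forall ij : I * I, exists n0, forall n, (n0 <= n)%N ->
    (1 - 2 * e) * mdist (pt ij.1) (pt ij.2) <=
    cut_metric n beyond weight (pt ij.1) (pt ij.2).
  by move=> ij; exact: cut_metric_ge.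
exists (\max_ij N ij) => i j; apply: (NP (i, j)).
by have := leq_bigmax (F := N) (i, j).
Qed.

End tree_pieces.

(** * Embedding the free space by evaluation on the pieces *)

Lemma closure_norm {R : realType} {V : normedModType R} (A : set V) (u : V) (d : R) :
  0 < d -> closure A u -> exists v, A v /\ `|u - v| < d.
Proof. by move=> d0 /(_ _ (nbhs_ball_norm u (PosNum d0))). Qed.

Section evaluation_operator.
Context {R : realType} {M : metricType R} (x0 : M).
Variables (beyond : nat -> M -> bool) (weight : nat -> R) (e : R).
Hypothesis weight_ge0 : forall N, 0 <= weight N.
Hypothesis beyond_base : forall N, beyond N x0 = false.
Hypothesis compat : forall N N', compatible_cuts (beyond N) (beyond N').
Hypothesis e01 : 0 < e < 1 / 2.
Hypothesis cut_le : forall n y z, cut_metric n beyond weight y z <= (1 + e) * mdist y z.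
Hypothesis cut_ge : forall (I : finType) (pt : I -> M), exists n, forall i j,
  (1 - 2 * e) * mdist (pt i) (pt j) <= cut_metric n beyond weight (pt i) (pt j).

Lemma cut_fun_lip n (s : nat -> R) y z : (forall N, `|s N| <= 1) ->
  `|\sum_(N < n) s N * (weight N * (beyond N y)%:R) -
    \sum_(N < n) s N * (weight N * (beyond N z)%:R)| <= (1 + e) * mdist y z.
Proof.
move=> s1; apply: le_trans (cut_le n y z); rewrite -sumrB.
apply: le_trans (ler_norm_sum _ _ _) _; apply: ler_sum => N _.
rewrite -!mulrBr !normrM mulrA (ger0_norm (weight_ge0 N)).
apply: ler_pM => //; first by rewrite mulr_ge0.
  by rewrite ler_piMl.
by case: (beyond N y) (beyond N z) => [] []; rewrite /= ?subrr ?subr0 ?sub0r ?normrN ?normr0 ?normr1.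
Qed.

Lemma cut_fun_subproof N : (fun y => weight N * (beyond N y)%:R) \in lip0 x0.
Proof.
apply/asboolP; split; first by rewrite beyond_base mulr0.
exists (1 + e) => y z.
have := @cut_fun_lip N.+1 (fun i => (i == N)%:R) y z; rewrite !big_ord_recr/= eqxx !mul1r.
rewrite !big1 ?add0r => [h|i _|i _]; last 2 first.
- by rewrite ltn_eqF ?mul0r.
- by rewrite ltn_eqF ?mul0r.
by apply: h => i; case: eqP; rewrite ?normr0 ?normr1.
Qed.

Definition cut_fun N : Lip0 x0 := MkLip0 (cut_fun_subproof N).

Implicit Types u v : dual (Lip0 x0).

Lemma dual_sum u n (c : 'I_n -> R) (f : 'I_n -> Lip0 x0) :
  u (\sum_i c i *: f i) = \sum_i c i * u (f i).
Proof.
have [ul _] := dualP u; pose Q (g : Lip0 x0) (r : R) := u g = r.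
apply: (big_ind2 Q) => [|f1 r1 f2 r2|i _]; rewrite /Q; first exact: dual0.
  by move=> <- <-; have := ul 1 f1 f2; rewrite scale1r mul1r.
exact: dualZ.
Qed.

Lemma lip0_sumE n (c : 'I_n -> R) (f : 'I_n -> Lip0 x0) y :
  (\sum_i c i *: f i) y = \sum_i c i * f i y.
Proof.
pose Q (g : Lip0 x0) (r : R) := g y = r.
by apply: (big_ind2 Q) => // g1 r1 g2 r2; rewrite /Q => <- <-.
Qed.

(** Apply [u] to the combination of the cut functions with the signs of its
    values. *)
Lemma eval_sum_le u n : \sum_(N < n) `|u (cut_fun N)| <= (1 + e) * `|u|.
Proof.
pose s N := Num.sg (u (cut_fun N)).
have s1 N : `|s N| <= 1 by rewrite /s normr_sg; case: (_ != 0).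
have -> : \sum_(N < n) `|u (cut_fun N)| = u (\sum_(N < n) s N *: cut_fun N).
  rewrite dual_sum; apply: eq_bigr => N _.
  by rewrite normrEsg.
apply: le_trans (ler_norm _) _; apply: le_trans (dualnormP _ _) _.
rewrite mulrC; apply: ler_wpM2r; first exact: dualnorm_ge0.
have /andP[e0 _] := e01.
apply: lipnorm_le => [|y z]; first by rewrite addr_ge0// ltW.
by rewrite !lip0_sumE; exact: cut_fun_lip.
Qed.

Lemma eval_summable u : (fun N => u (cut_fun N)) \in @summable_seq R.
Proof.
apply/asboolP; apply: (abs_series_le (C := (1 + e) * `|u|) _).1 => n.
by rewrite /abs_series /series/= big_mkord; exact: eval_sum_le.
Qed.

Definition eval_ell1 u : ell1 R := MkEll1 (eval_summable u).

Lemma eval_ell1_le u : `|eval_ell1 u| <= (1 + e) * `|u|.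
Proof. by apply: ell1norm_le => n; exact: eval_sum_le. Qed.

Lemma eval_ell1_linear a u v : eval_ell1 (a *: u + v) = a *: eval_ell1 u + eval_ell1 v.
Proof. by apply/val_inj. Qed.

(** On finitely many points a Lipschitz function is, by duality, a combination
    of the cut functions. *)
Lemma eval_ell1_ge_span v : linear_span (range (delta x0)) v ->
  (1 - 2 * e) * `|v| <= `|eval_ell1 v|.
Proof.
move=> [r [c [w [ws ->]]]].
have /choice[pt ptE] : forall i, exists y, w i = delta x0 y.
  by move=> i; have [y _ <-] := ws i; exists y.
set v0 := \sum_(i < r) _.
have v0E f : v0 f = \sum_(i < r) c i * f (pt i).
  rewrite /v0; pose Q (u : dual (Lip0 x0)) (t : R) := u f = t.
  apply: (big_ind2 Q) => // [u1 t1 u2 t2|i _]; rewrite /Q; first by move=> <- <-.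
  by rewrite ptE.
have /andP[e0 e2] := e01; have e21 : 0 < 1 - 2 * e by lra.
rewrite mulrC -ler_pdivlMr//; apply: dualnorm_le; first by rewrite divr_ge0 ?(ltW e21).
move=> f; rewrite mulrAC ler_pdivlMr// mulrC.
pose P (i : option 'I_r) := if i is Some j then pt j else x0.
have [n nP] := cut_ge P.
have f0 : f x0 = 0 by have [] := Lip0P f.
have [||i j|d dw dE] := @laminar_duality R _ n (fun N i => beyond N (P i))
    (fun N => `|f| * weight N) (fun i => (1 - 2 * e) * f (P i)).
- by move=> N _; rewrite mulr_ge0.
- move=> N N' _ _; case: (compat N N') => H; [apply: Or31|apply: Or32|apply: Or33] => i;
    exact: H.
- rewrite -mulrBr normrM (gtr0_norm e21).
  apply: le_trans (_ : `|f| * ((1 - 2 * e) * mdist (P i) (P j)) <= _).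
    by rewrite mulrCA ler_wpM2l ?(ltW e21)//; exact: lip0_diff.
  apply: le_trans (ler_wpM2l (normr_ge0 _) (nP i j)) _.
  by rewrite /cut_metric mulr_sumr; apply: ler_sum => N _; rewrite mulrA.
have fE i : (1 - 2 * e) * f (pt i) = \sum_(N < n) d N * (beyond N (pt i))%:R.
  have := dE (Some i) None; rewrite /= f0 mulr0 subr0 => ->.
  by apply: eq_bigr => N _; rewrite beyond_base subr0.
have -> : (1 - 2 * e) * `|v0 f| = `|\sum_(N < n) d N * \sum_(i < r) c i * (beyond N (pt i))%:R|.
  rewrite -[X in X * _]gtr0_norm// -normrM v0E mulr_sumr; congr `|_|.
  under eq_bigr do rewrite mulrCA fE mulr_sumr.
  rewrite exchange_big/=; apply: eq_bigr => N _; rewrite mulr_sumr.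
  by apply: eq_bigr => i _; rewrite mulrCA.
apply: le_trans (ler_norm_sum _ _ _) _.
apply: le_trans (_ : `|f| * head n (eval_ell1 v0) <= _); last first.
  by rewrite mulrC ler_wpM2r// head_le_norm.
rewrite mulr_sumr; apply: ler_sum => N _.
have -> : eval_ell1 v0 N = weight N * \sum_(i < r) c i * (beyond N (pt i))%:R.
  rewrite /eval_ell1/= v0E mulr_sumr; apply: eq_bigr => i _ /=.
  by rewrite mulrCA.
by rewrite !normrM mulrA (ger0_norm (weight_ge0 N)) ler_wpM2r// dw.
Qed.

(** The bound extends from the span of the evaluations to its closure, as the
    operator is bounded. *)
Lemma eval_ell1_ge (u : free_space x0) : (1 - 2 * e) * `|u| <= `|eval_ell1 u|.
Proof.
have /andP[e0 e2] := e01; apply/ler_addgt0Pr => d d0.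
have d3 : 0 < d / 3 by rewrite divr_gt0.
have [v [vs uv]] : exists v : dual (Lip0 x0),
    linear_span (range (delta x0)) v /\ `|(u : dual (Lip0 x0)) - v| < d / 3.
  by case: u => u /= /asboolP uc; exact: closure_norm.
have h1 := eval_ell1_ge_span vs.
have h2 : `|u| <= `|v| + `|(u : dual (Lip0 x0)) - v|.
  by have := ler_normD v ((u : dual (Lip0 x0)) - v); rewrite addrC subrK.
have h3 := eval_ell1_le (v - u).
have h4 : `|eval_ell1 v| <= `|eval_ell1 u| + `|eval_ell1 (v - u)|.
  have := ler_normD (eval_ell1 u) (eval_ell1 (v - u)).
  have -> : eval_ell1 u + eval_ell1 (v - u) = eval_ell1 v.
    by rewrite -[eval_ell1 u]scale1r -eval_ell1_linear scale1r addrC subrK.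
  exact.
rewrite distrC in h3.
nra.
Qed.

Lemma cuts_iso : iso_to_subspace ((1 + e) / (1 - 2 * e) - 1) (free_space x0) (ell1 R).
Proof.
have /andP[e0 e2] := e01; have e21 : 0 < 1 - 2 * e by lra.
pose S (u : free_space x0) : ell1 R := (1 - 2 * e)^-1 *: eval_ell1 u.
have linS : linear S.
  by move=> a u v; rewrite /S eval_ell1_linear scalerDr !scalerA mulrC.
pose Sl : {linear free_space x0 -> ell1 R} :=
  HB.pack S (GRing.isLinear.Build R (free_space x0) (ell1 R) _ S linS).
exists Sl => u; have -> : Sl u = S u by [].
rewrite /S normrZ ger0_norm ?invr_ge0 ?(ltW e21)//.
have -> : 1 + ((1 + e) / (1 - 2 * e) - 1) = (1 + e) / (1 - 2 * e) by rewrite addrC subrK.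
apply/andP; split; first by rewrite mulrC ler_pdivlMr// mulrC eval_ell1_ge.
by rewrite [leRHS]mulrAC [leLHS]mulrC ler_pM2r ?invr_gt0// eval_ell1_le.
Qed.

End evaluation_operator.

Section ell1_from_tree.
Context {R : realType} {M : completeMetricType R} (x0 : M).

Lemma separable_dense_seq : separable M ->
  exists x : nat -> M, forall y (e : R), 0 < e -> exists k, mdist y (x k) < e.
Proof.
move=> [D /countable_injP[f finj] dD].
exists (fun n => xget x0 [set y | D y /\ f y = n]) => y e e0.
have [||z [/= yz Dz]] := dD [set z | mdist y z < e].
- by exists y; rewrite /= mdistxx.
- apply: open_mdist => z yz; exists (e - mdist y z); first by rewrite subr_gt0.
  by move=> w zw; have := metric_triangle y z w; rewrite /=; lra.
exists (f z); case: xgetP => [w _ [Dw fwz]|/(_ z)[]//].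
by rewrite (finj w z) ?inE.
Qed.

(** The distortion 1 + E is reached when [e] solves
    (1 + e) / (1 - 2 e) = 1 + E. *)
Lemma tree_null_iso (x : nat -> M) : four_point M ->
  (forall y (e : R), 0 < e -> exists k, mdist y (x k) < e) ->
  (forall z, outer_length (heights_on x0 z) = 0%E) ->
  forall e : R, 0 < e -> iso_to_subspace e (free_space x0) (ell1 R).
Proof.
move=> fpM xd hn E E0; pose e := E / (3 + 2 * E).
have D0 : 0 < 3 + 2 * E by lra.
have e01 : 0 < e < 1 / 2 by rewrite divr_gt0//= ltr_pdivrMr//; lra.
have e01' : 0 < e < 1 by move/andP: e01 => [-> ?] /=; lra.
have [P _] : exists _ : pieces x0 x e, True by exact: pieces_exist.
have -> : E = (1 + e) / (1 - 2 * e) - 1.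
  have h : 1 - 2 * e != 0 by have /andP[_] := e01; move=> ?; apply/eqP; lra.
  apply: (mulIf h); rewrite mulrBl divfK// /e; field.
  by apply/eqP; lra.
apply: (@cuts_iso R M x0 (beyond P) (weight P) e) => //.
- exact: weight_ge0.
- exact: beyond_base.
- exact: beyond_compatible.
- exact: cut_metric_le.
- exact: cut_metric_ge_fin.
Qed.

End ell1_from_tree.

(** * The equivalence *)

Section null_traces.
Context {R : realType} {M : metricType R} {T : metricType R} (x0 : M) (i : M -> T).
Hypothesis treeT : rtree [set: T].
Hypothesis isoi : isometry_on setT i.

Lemma isometry_four_point : four_point M.
Proof. by move=> x y u v; rewrite -!isoi//; exact: rtree_four_point. Qed.

(** The chart is the distance to [x], which is 1-Lipschitz on the whole tree and
    isometric on the segment. *)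
Lemma chart_trace_null x y (I : set T) :
  (forall e : R, 0 < e -> iso_to_subspace e (free_space x0) (ell1 R)) ->
  x <> y -> is_arc x y I ->
  outer_length (segment_chart x @` (range i `&` I)) = 0%E.
Proof.
move=> emb xy arcI; have [g [g0 g1 geo im]] := rtree_arc treeT xy arcI.
have -> : segment_chart x @` (range i `&` I) =
    (fun z => mdist x (i z)) @` [set z | I (i z)].
  apply/seteqP; split=> [_ [_ [[z _ <-] Iz] <-]|_ [z Iz <-]]; first by exists z.
  by exists (i z) => //; split=> //; exists z.
have onI p : I p -> exists s, [/\ 0 <= s, s <= mdist x y, g s = p & mdist x p = s].
  rewrite -im => -[s]; rewrite /= in_itv/= => /andP[s0 sd] <-.
  by exists s; split=> //; have := geo 0 s (lexx _) s0 sd; rewrite g0 subr0.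
apply: (ell1_embedding_null emb).
- move=> z w; rewrite mul1r -(isoi (p := z) (q := w))//.
  have h1 := metric_triangle x (i z) (i w); have h2 := metric_triangle x (i w) (i z).
  by rewrite (metric_sym (i w)) in h2; rewrite ler_norml; apply/andP; split; lra.
- move=> z w Iz Iw; rewrite -isoi//.
  have [s [s0 s1 gs ->]] := onI _ Iz; have [t [t0 t1 gt ->]] := onI _ Iw.
  rewrite -gs -gt; have [st|/ltW ts] := leP s t.
    by rewrite distrC ger0_norm ?subr_ge0// geo.
  by rewrite ger0_norm ?subr_ge0// metric_sym geo.
- by exists 0 => _ [z _ <-]; exact: mdist_ge0.
- by exists (mdist x y) => _ [z Iz <-]; have [s [_ ? _ ->]] := onI _ Iz.
Qed.

(** A point of [M] that counts in [heights_on] lies between [x0] and [z], hence on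
    the arc between their images, and its height is its chart. *)
Lemma heights_trace_null z :
  length_measure (rtree_conv (range i)) (range i) = 0%E ->
  outer_length (heights_on x0 z) = 0%E.
Proof.
move=> len0; have [->|/eqP zx0] := eqVneq z x0.
  apply: outer_length_subset0 (outer_length_set1 0) => t [y [yt my]].
  have := gromov_lel x0 x0 y; rewrite mdistxx my; have := mdist_ge0 y x0.
  by rewrite yt /= => *; lra.
have izx0 : i x0 <> i z.
  move=> E; apply: zx0; apply: mdist_positivity; rewrite -isoi// E mdistxx //.
have convi y : rtree_conv (range i) (i y) by move=> B [_]; apply; exists y.
have [I [IC arcI _ _]] := rtree_rtree_conv treeT (convi x0) (convi z) izx0.
have seg0 : (segment_measure (i x0) (range i `&` I) <= 0)%E.
  rewrite -len0; apply: ereal_sup_ubound.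
  exists 1%N, (fun=> i x0), (fun=> i z), (fun=> I); split=> [//||].
    by move=> j k _ _ _; rewrite (ord1 j) (ord1 k).
  by rewrite big_ord1.
apply: (@outer_length_subset0 _ _ (segment_chart (i x0) @` (range i `&` I))).
  move=> t [y [yt my]]; exists (i y); last first.
    by rewrite /segment_chart isoi// metric_sym.
  split; first by exists y.
  apply: (between_on_arc treeT izx0 arcI); rewrite !isoi//.
  rewrite (metric_sym x0 y) (metric_sym x0 z) (metric_sym y z).
  by move: my; rewrite /gromov -yt; lra.
by apply/eqP; rewrite eq_le outer_length_ge0 andbT.
Qed.

End null_traces.

Theorem theorem1p2 (R : realType) (M : completeMetricType R) (x0 : M)
    (sepM : separable M) :
  (forall e : R, 0 < e -> iso_to_subspace e (free_space x0) (ell1 R)) <->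
  (exists (T : metricType R) (i : M -> T),
    [/\ rtree [set: T], isometry_on setT i,
        length_measurable (rtree_conv (range i)) (range i) &
        length_measure (rtree_conv (range i)) (range i) = 0%E]).
Proof.
split=> [emb|[T [i [treeT isoi _ len0]]]]; last first.
  have [x xd] := separable_dense_seq x0 sepM.
  apply: (tree_null_iso (isometry_four_point treeT isoi) xd) => z.
  exact: heights_trace_null len0.
have fpM := ell1_embedding_four_point emb.
exists (tree_hull x0 fpM), (fun x => hull_pt x0 fpM x (mdist x x0)).
set i := (fun x => _).
have treeT : rtree [set: tree_hull x0 fpM] by exact: tree_hull_rtree.
have isoi : isometry_on setT i by move=> x y _ _; exact: hull_embedding_isometry.
have null x y I : segment (rtree_conv (range i)) x y I ->
    outer_length (segment_chart x @` (range i `&` I)) = 0%E.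
  by move=> [xy _ arcI]; exact: (chart_trace_null treeT isoi emb xy arcI).
split=> //; first by move=> x y I /null; exact: outer_length0_measurable.
apply/eqP; rewrite eq_le; apply/andP; split.
  apply: ge_ereal_sup => _ [n [x [y [I [segI _ ->]]]]].
  by rewrite big1// => k _; exact: (null _ _ _ (segI k)).
apply: ereal_sup_ubound; exists 0%N, (fun=> i x0), (fun=> i x0), (fun=> set0).
by split; [case|move=> []|rewrite big_ord0].
Qed.
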